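(* Let $p$ be a prime number. The following two assertions are equivalent. (a) (Ledet's conjecture) For every field $k$ of characteristic $p$ and every integer $n\ge 1$, the essential dimension of the cyclic group of order $p^n$ over $k$ is $n$, i.e. $\operatorname{ed}_k(\mathbb{Z}/p^n\mathbb{Z})=n$. (b) For every field $k$ of characteristic $p$ and every finite unipotent commutative étale group scheme $G$ over $k$, one has $\operatorname{ed}_k G\ge n_V(G)$.
   Context: Essential dimension: let $G$ be an affine group scheme of finite type over a field $k$. For a field extension $K/k$, $\operatorname{H}^1(\operatorname{Spec} K,G)$ is the pointed set of isomorphism classes of fppf $G$-torsors over $\operatorname{Spec} K$. For a $G$-torsor $\xi$ over $\operatorname{Spec} K$, $\operatorname{ed}_k\xi$ is the smallest integer $n\ge 0$ such that there is an intermediate field $k\subseteq L\subseteq K$ with $\operatorname{tr\,deg}(L/k)=n$ and with $[\xi]$ in the image of $\operatorname{H}^1(\operatorname{Spec} L,G)\to \operatorname{H}^1(\operatorname{Spec} K,G)$. Then $\operatorname{ed}_k G$ is the supremum of $\operatorname{ed}_k\xi$ over all field extensions $K/k$ and all $G$-torsors $\xi$ over $\operatorname{Spec} K$. Verschiebung and $V$-order: for a commutative group scheme $G$ over a field $k$ of characteristic $p>0$, let $G^{(p)}$ be the base change of $G$ along the absolute Frobenius of $\operatorname{Spec} k$, and let $V:G^{(p)}\to G$ be the Verschiebung homomorphism (for finite $G$, the Cartier dual of the relative Frobenius $G^\vee\to (G^{\vee})^{(p)}$). Its $n$-th iterate is $V^n:G^{(p^n)}\to G$. For $G$ commutative unipotent,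 the $V$-order $n_V(G)$ is the smallest integer $n\ge 1$ such that $V^n=0$ on $G$.
   Formalization: Assertion (b) is stated for nontrivial G only: the trivial group has n_V = 1 under the convention ''smallest n ≥ 1 with V^n = 0'' but essential dimension 0, so (b) read literally is false for it. *)

(* Defs.v *)
From HB Require Import structures.
From mathcomp Require Import all_boot all_order all_algebra.
From mathcomp Require Import boolp.
From mathcomp Require Import mpoly.

Set Implicit Arguments.
Unset Strict Implicit.
Unset Printing Implicit Defensive.

Import GRing.Theory.
Local Open Scope ring_scope.

(* Extended naturals: [None] stands for +oo. *)
Definition enat := option nat.

Definition le_enat (x y : enat) : bool :=
  match x, y with
  | _, None => true
  | None, Some _ => false
  | Some m, Some n => (m <= n)%N
  end.

(* The least element of a set of naturals, +oo when the set is empty. *)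
Definition least (P : nat -> Prop) : enat :=
  if pselect (exists n, `[< P n >]) is left h then Some (ex_minn h) else None.

(* Finite-dimensional algebras, Hopf algebras and comodules are given on      *)
(* coordinate spaces by structure constants, so that base change applies the  *)
(* field morphism to the constants.  Elements are row vectors, a linear map   *)
(* is a matrix acting on the right, and F^m (x) F^n is 'M_(m, n), the pure    *)
(* tensor u (x) v being u^T *m v; thus (f (x) g)(X) = f^T *m X *m g.          *)

Record fin_alg (F : fieldType) (n : nat) := FinAlg {
  mul_basis : 'I_n -> 'I_n -> 'rV[F]_n;
  one_alg : 'rV[F]_n }.

(* The data of the coordinate ring of a finite group scheme of order n; the   *)
(* axioms are [is_group_scheme] below.                                        *)
Record fin_hopf (F : fieldType) (n : nat) := FinHopf {
  hopf_alg :> fin_alg F n;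
  comul_basis : 'I_n -> 'M[F]_n;
  counit : 'cV[F]_n }.

(* A finite scheme with a right action of a group scheme of order n. *)
Record fin_space (F : fieldType) (n : nat) := FinSpace {
  space_dim : nat;
  space_alg :> fin_alg F space_dim;
  coact_basis : 'I_space_dim -> 'M[F]_(space_dim, n) }.

Section Algebra.
Variable F : fieldType.

Definition linear_ext m n1 n2 (f : 'I_m -> 'M[F]_(n1, n2)) (u : 'rV[F]_m) :
    'M[F]_(n1, n2) :=
  \sum_i u 0 i *: f i.

(* The multiplication A (x) A -> A. *)
Definition mul_tensor n (A : fin_alg F n) (X : 'M[F]_n) : 'rV[F]_n :=
  \sum_i \sum_j X i j *: mul_basis A i j.

Definition mul_alg n (A : fin_alg F n) (u v : 'rV[F]_n) : 'rV[F]_n :=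
  mul_tensor A (u^T *m v).

Definition exp_alg n (A : fin_alg F n) (u : 'rV[F]_n) (q : nat) : 'rV[F]_n :=
  iter q (mul_alg A u) (one_alg A).

(* The multiplication of the algebra A (x) B. *)
Definition mul2 m n (A : fin_alg F m) (B : fin_alg F n) (X Y : 'M[F]_(m, n)) :
    'M[F]_(m, n) :=
  \sum_i \sum_j \sum_k \sum_l
    (X i j * Y k l) *: ((mul_basis A i k)^T *m mul_basis B j l).

Definition one2 m n (A : fin_alg F m) (B : fin_alg F n) : 'M[F]_(m, n) :=
  (one_alg A)^T *m one_alg B.

Definition is_com_alg n (A : fin_alg F n) : Prop :=
  [/\ forall u v w, mul_alg A (mul_alg A u v) w = mul_alg A u (mul_alg A v w),
      forall u v, mul_alg A u v = mul_alg A v u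
    & forall u, mul_alg A (one_alg A) u = u].

Definition is_alg_hom m n (A : fin_alg F m) (B : fin_alg F n)
    (f : 'M[F]_(m, n)) : Prop :=
  one_alg A *m f = one_alg B /\
  forall u v, mul_alg A u v *m f = mul_alg B (u *m f) (v *m f).

(* An algebra morphism C -> A (x) B given on the basis of C. *)
Definition is_alg_hom2 l m n (C : fin_alg F l) (A : fin_alg F m)
    (B : fin_alg F n) (f : 'I_l -> 'M[F]_(m, n)) : Prop :=
  linear_ext f (one_alg C) = one2 A B /\
  forall u v, linear_ext f (mul_alg C u v)
              = mul2 A B (linear_ext f u) (linear_ext f v).

(* The product algebra F^n. *)
Definition prod_alg n : fin_alg F n :=
  FinAlg (fun i j => (i == j)%:R *: delta_mx 0 i) (const_mx 1).

(* Right comodules: (rho (x) 1) rho = (1 (x) Delta) rho, in coordinates on    *)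
(* e_b (x) h_t (x) h_s, and (1 (x) epsilon) rho = 1.                          *)
Definition is_comodule n (G : fin_hopf F n) d
    (rho : 'I_d -> 'M[F]_(d, n)) : Prop :=
  (forall i b t s, \sum_a rho i a s * rho a b t
                   = \sum_r rho i b r * comul_basis G r t s) /\
  (forall i, rho i *m counit G = delta_mx i 0).

Definition is_group_scheme n (G : fin_hopf F n) : Prop :=
  [/\ is_com_alg G,
      is_comodule G (comul_basis G) /\
        (forall i, (comul_basis G i)^T *m counit G = delta_mx i 0),
      is_alg_hom2 G G G (comul_basis G),
      one_alg G *m counit G = 1 /\
        (forall u v, mul_alg G u v *m counit G
                     = (u *m counit G) *m (v *m counit G))
    & exists S : 'M[F]_n, forall i,
        mul_tensor G (S^T *m comul_basis G i) = counit G i 0 *: one_alg G /\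
        mul_tensor G (comul_basis G i *m S) = counit G i 0 *: one_alg G].

Definition is_commutative n (G : fin_hopf F n) : Prop :=
  forall i, (comul_basis G i)^T = comul_basis G i.

(* Every nonzero representation has a nonzero fixed vector; since every       *)
(* representation is the union of its finite-dimensional subrepresentations,  *)
(* those suffice.                                                             *)
Definition is_unipotent n (G : fin_hopf F n) : Prop :=
  forall d (rho : 'I_d -> 'M[F]_(d, n)), (0 < d)%N -> is_comodule G rho ->
  exists2 v : 'rV[F]_d, v != 0 & linear_ext rho v = v^T *m one_alg G.

(* Torsors under affine group schemes are affine by descent; over a field, an *)
(* affine scheme with an action of G is an fppf torsor iff it is nonempty and *)
(* X x G -> X x X, (x, g) |-> (x, xg), is an isomorphism.  For G finite, X is *)
(* then finite.                                                               *)
Definition torsor_map n (G : fin_hopf F n) (T : fin_space F n)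
    (X : 'M[F]_(space_dim T)) : 'M[F]_(space_dim T, n) :=
  \sum_i \sum_j X i j *:
    mul2 T G ((delta_mx 0 i)^T *m one_alg G) (coact_basis j).

Definition is_torsor n (G : fin_hopf F n) (T : fin_space F n) : Prop :=
  [/\ (0 < space_dim T)%N, is_com_alg T,
      is_comodule G (@coact_basis F n T),
      is_alg_hom2 T T G (@coact_basis F n T)
    & bijective (@torsor_map n G T)].

(* Isomorphism of schemes with an action, given by its comorphism f : the     *)
(* last condition is (f (x) 1) rho_S = rho_T f.                               *)
Definition space_iso n (S T : fin_space F n) : Prop :=
  exists f : 'M[F]_(space_dim S, space_dim T),
    [/\ bijective (fun u : 'rV[F]_(space_dim S) => u *m f), is_alg_hom S T f
      & forall i : 'I_(space_dim S),
          f^T *m coact_basis i = linear_ext (@coact_basis F n T) (row i f)].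

(* The constant group scheme Z/m: its coordinate ring is F^(Z/m), with basis  *)
(* the indicator functions e_c, and Delta(e_c) = sum_(a+b=c) e_a (x) e_b.     *)
Definition const_Zm m : fin_hopf F m :=
  FinHopf (prod_alg m)
    (fun c => \matrix_(a, b) ((a + b) %% m == c)%N%:R)
    (\col_a (a == 0%N :> nat)%:R).

(* Cartier dual, on the dual basis. *)
Definition cartier_dual n (G : fin_hopf F n) : fin_hopf F n :=
  FinHopf
    (FinAlg (fun i j => \row_k comul_basis G k i j) (counit G)^T)
    (fun k => \matrix_(i, j) mul_basis G i j 0 k)
    (one_alg G)^T.

End Algebra.

Section BaseChange.
Variables (F K : fieldType) (f : {rmorphism F -> K}).

Definition alg_bc n (A : fin_alg F n) : fin_alg K n :=
  FinAlg (fun i j => map_mx f (mul_basis A i j)) (map_mx f (one_alg A)).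

Definition hopf_bc n (G : fin_hopf F n) : fin_hopf K n :=
  FinHopf (alg_bc G) (fun i => map_mx f (comul_basis G i))
    (map_mx f (counit G)).

Definition space_bc n (T : fin_space F n) : fin_space K n :=
  @FinSpace K n (space_dim T) (alg_bc T)
    (fun i => map_mx f (@coact_basis F n T i)).

End BaseChange.

(* Etale algebras in the sense of Bourbaki (Algebra, V.6): those which become *)
(* isomorphic to a product algebra after some extension of the base field.    *)
Definition is_etale (k : fieldType) n (G : fin_hopf k n) : Prop :=
  exists (K : fieldType) (f : {rmorphism k -> K}) (M : 'M[K]_n),
    is_alg_hom (alg_bc f G) (prod_alg K n) M /\
    bijective (fun u : 'rV[K]_n => u *m M).

Section Verschiebung.
Variables (p : nat) (k : fieldType) (pchar_k : p \in [pchar k]).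

Definition frob_twist n (G : fin_hopf k n) : fin_hopf k n :=
  hopf_bc (pFrobenius_aut pchar_k) G.

(* Comorphism A^(p) -> A of the relative Frobenius of Spec A. *)
Definition rel_frobenius n (A : fin_alg k n) : 'M[k]_n :=
  \matrix_i exp_alg A (delta_mx 0 i) p.

(* Comorphism of V : G^(p) -> G: the Cartier dual of the relative Frobenius   *)
(* of the Cartier dual of G.                                                  *)
Definition verschiebung n (G : fin_hopf k n) : 'M[k]_n :=
  (rel_frobenius (cartier_dual G))^T.

(* Comorphism of V^m : G^(p^m) -> ... -> G^(p) -> G. *)
Fixpoint verschiebung_iter n (m : nat) (G : fin_hopf k n) : 'M[k]_n :=
  if m is m'.+1 then verschiebung G *m verschiebung_iter m' (frob_twist G)
  else 1%:M.

(* The comorphism of the trivial homomorphism G' -> G is the counit of G      *)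
(* followed by the unit of G'.                                                *)
Definition verschiebung_iter_trivial n (m : nat) (G : fin_hopf k n) : Prop :=
  verschiebung_iter m G = counit G *m one_alg (iter m (@frob_twist n) G).

(* The trivial group has V-order 1 although its essential dimension is 0. *)
Definition V_order n (G : fin_hopf k n) : enat :=
  least (fun m => (0 < m)%N /\ verschiebung_iter_trivial m G).

End Verschiebung.

(* tr.deg(L/k) = n: there is a transcendence basis t_1, ..., t_n, i.e. t is   *)
(* algebraically independent and L is algebraic over k(t), equivalently over  *)
(* k[t].                                                                      *)
Definition has_trdeg (k L : fieldType) (i : {rmorphism k -> L}) (n : nat) :
    Prop :=
  exists t : 'I_n -> L, injective (mmap i t) /\
    forall x : L, exists2 P : {poly {mpoly k[n]}},
      P != 0 & root (map_poly (mmap i t) P) x.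

(* The torsor T over K is defined over an intermediate field k <= L <= K of   *)
(* transcendence degree n over k.                                             *)
Definition defined_in_trdeg (k K : fieldType) (iota : {rmorphism k -> K}) m
    (G : fin_hopf k m) (T : fin_space K m) (n : nat) : Prop :=
  exists (L : fieldType) (i : {rmorphism k -> L}) (j : {rmorphism L -> K}),
    [/\ j \o i =1 iota, has_trdeg i n
      & exists2 S : fin_space L m,
          is_torsor (hopf_bc i G) S & space_iso (space_bc j S) T].

Definition ed_torsor (k K : fieldType) (iota : {rmorphism k -> K}) m
    (G : fin_hopf k m) (T : fin_space K m) : enat :=
  least (defined_in_trdeg iota G T).

(* The supremum is the least upper bound in the extended naturals. *)
Definition ed (k : fieldType) m (G : fin_hopf k m) : enat :=
  least (fun n => forall (K : fieldType) (iota : {rmorphism k -> K})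
    (T : fin_space K m), is_torsor (hopf_bc iota G) T ->
    le_enat (ed_torsor iota G T) (Some n)).

(* Main.v *)
(* Only two essential dimensions have to be compared.  If G is a finite
   commutative unipotent group scheme which becomes constant over K, the points
   of G over K form a commutative p-group, because unipotent representations are
   unitriangular.  On a point g the iterate V^m takes the value g^(p^m) (up to
   the Frobenius of K), so the V-order of G is bounded by the e for which p^e is
   the exponent of this group; for Z/p^n it is at least n.

   (a) => (b).  The group of points is a product Z/p^e x H.  A Z/p^e-torsor T over
   an extension of K induces a G-torsor; if the latter is defined over a field
   L0, then its quotient by H, which is T, is defined over the algebraic closure
   of K L0 in the big field.  Hence ed (Z/p^e) <= ed G.

   (b) => (a).  Only ed (Z/p^n) <= n remains.  Instead of Witt vectors we use
   Albert's construction of cyclic extensions of degree p^n: the algebra of a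
   Z/p^n-torsor has a basis of monomials in x_1, ..., x_n whose structure
   constants are polynomials in n scalars a_1, ..., a_n, where x_i^p - x_i - a_i
   and sigma x_i - x_i lie in the algebra generated by x_1, ..., x_(i-1). *)

Require Import Defs.
From HB Require Import structures.
From mathcomp Require Import all_boot all_order all_algebra all_fingroup all_solvable.
From mathcomp Require Import boolp mpoly ring zify.

Set Implicit Arguments.
Unset Strict Implicit.
Unset Printing Implicit Defensive.

(** * Finite commutative groups with a cyclic direct factor *)

(* A group [X] as a product [Z/q x H], presented by the projection [alpha] to
   [Z/q], its section [pw], and the translation action of [X] on the set [H]. *)
Record cyclic_splitting (X : Type) (q : nat) (mul : X -> X -> X) (one : X)
    (H : finType) (act : H -> X -> H) (alpha : X -> 'I_q) (pw : 'I_q -> X) : Prop := {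
  split_actM : forall t a b, act (act t a) b = act t (mul a b);
  split_alphaM : forall a b, alpha (mul a b) = alpha a + alpha b %[mod q];
  split_unique : forall t t' a, exists c,
    (act t c = t' /\ alpha c = a) /\ forall c', act t c' = t' -> alpha c' = a -> c' = c;
  split_act1 : forall t, act t one = t;
  split_alpha1 : alpha one = 0 :> nat;
  split_act_pw : forall t a, act t (pw a) = t;
  split_alpha_pw : forall a, alpha (pw a) = a }.

Section CyclicQuotient.
Local Open Scope group_scope.

Lemma abelian_p_cyclic_splitting (gT : finGroupType) (p N : nat) :
  prime p -> (forall a b : gT, a * b = b * a) -> (forall a : gT, a ^+ (p ^ N)%N = 1) ->
  exists e (H : finType) (act : H -> gT -> H) (alpha : gT -> 'I_(p ^ e)) pw (t0 : H),
    (forall a : gT, a ^+ (p ^ e)%N = 1) /\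
    cyclic_splitting (fun a b : gT => a * b) 1 act alpha pw.
Proof.
move=> p_pr mulC exp_pN; pose G := [group of [set: gT]].
have G_ab : abelian G by apply/centsP => a _ b _; exact: mulC.
have [x Gx ox] := exponent_witness (abelian_nil G_ab).
have [e _ exp_e] : exists2 e, (e <= N)%N & exponent G = (p ^ e)%N.
  apply/dvdn_pfactor => //; apply/exponentP => a _; exact: exp_pN.
have q_gt0 : (0 < p ^ e)%N by rewrite expn_gt0 prime_gt0.
have /splitsP[H /complP[tixH defG]] := abelian_splits Gx (esym ox) G_ab.
have x_mod k l : k = l %[mod (p ^ e)%N] -> x ^+ k = x ^+ l.
  by move=> kl; apply/eqP; rewrite eq_expg_mod_order -ox exp_e; apply/eqP.
have xH k l : x ^+ k * (x ^+ l)^-1 \in H -> k = l %[mod (p ^ e)%N].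
  move=> klH; have : x ^+ k * (x ^+ l)^-1 \in <[x]> :&: H.
    by rewrite inE klH groupM ?groupV ?mem_cycle.
  rewrite tixH => /set1gP/eqP; rewrite -eq_mulgV1 eq_expg_mod_order -ox exp_e.
  by move/eqP.
have alphaP a : exists k : 'I_(p ^ e), x ^- k * a \in H.
  have : a \in <[x]> * H by rewrite defG inE.
  case/mulsgP=> _ h /cycleP[k ->] Hh ->.
  exists (Ordinal (ltn_pmod k q_gt0)).
  by rewrite (x_mod _ k) ?mulKg //= modn_mod.
pose alpha a := xchoose (alphaP a).
have alphaH a : x ^- alpha a * a \in H := xchooseP (alphaP a).
have alpha_eq a (k : 'I_(p ^ e)) h : h \in H -> a = x ^+ k * h -> alpha a = k.
  move=> Hh def_a; apply: val_inj.
  rewrite -[LHS](modn_small (ltn_ord _)) -[RHS](modn_small (ltn_ord _)).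
  apply/esym/xH; have := alphaH a; rewrite def_a mulgA groupMr //.
  by rewrite mulC.
have mulCC (a b c : gT) : a * (b * c) = b * (a * c) by rewrite !mulgA (mulC a).
have etaM (a b : gT) : x ^- alpha (a * b) * (a * b) = (x ^- alpha a * a) * (x ^- alpha b * b)
    /\ alpha (a * b) = (alpha a + alpha b)%N %[mod (p ^ e)%N].
  have ab_mod : alpha (a * b) = (alpha a + alpha b)%N %[mod (p ^ e)%N].
    apply: xH; have Hab := groupM (alphaH a) (alphaH b); have := alphaH (a * b).
    rewrite -groupV => /(groupM Hab); rewrite !invMg invgK expgD.
    set u := x ^+ alpha a; set v := x ^+ alpha b; set w := x ^+ alpha (a * b).
    rewrite !mulgA -(mulgA u^-1) (mulC a) !mulgA mulgK mulgK.
    by rewrite (mulC (u^-1 * v^-1)) (mulC u^-1) invMg mulgA.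
  split=> //; rewrite (x_mod _ _ ab_mod) expgD invMg -!mulgA; rewrite mulCC; congr (_ * _).
  by rewrite mulCC.
pose K := subg_of H; pose eta a : K := subg H (x ^- alpha a * a).
have eta_val a : sgval (eta a) = x ^- alpha a * a by rewrite subgK.
exists e, K, (fun t a => t * eta a), alpha, (fun k => x ^+ k), 1.
split=> [a|]; first by rewrite -exp_e expg_exponent ?inE.
have alpha1 : alpha 1 = Ordinal q_gt0 by apply: (alpha_eq _ _ 1) => //; rewrite mulg1.
have eta_pw (k : 'I_(p ^ e)) : eta (x ^+ k) = 1.
  apply: val_inj; rewrite /= eta_val (alpha_eq _ k 1) ?mulVg //.
  by rewrite mulg1.
split=> //.
- move=> t a b; apply: val_inj; rewrite /= -mulgA; congr (_ * _).
  by rewrite !eta_val (etaM a b).1.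
- by move=> a b; rewrite (etaM a b).2.
- move=> t t' k; pose h := sgval (t^-1 * t').
  have alpha_c : alpha (x ^+ k * h) = k by apply: (alpha_eq _ _ h) => //; exact: subgP.
  exists (x ^+ k * h); split=> [|c' ht' alpha_c'].
    split=> //; apply: val_inj; rewrite /= eta_val alpha_c mulKg /h /=.
    by rewrite mulKVg.
  have -> : h = x ^- k * c'.
    by rewrite /h -ht' mulKg eta_val alpha_c'.
  by rewrite mulKVg.
- move=> t; rewrite -[RHS]mulg1; congr (_ * _); rewrite -(eta_pw (Ordinal q_gt0)).
  by rewrite expg0.
- by rewrite alpha1.
- by move=> t k; rewrite eta_pw mulg1.
- by move=> k; apply: (alpha_eq _ _ 1) => //; rewrite mulg1.
Qed.

End CyclicQuotient.

Section TableGroup.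
Variables (n : nat) (mul : 'I_n -> 'I_n -> 'I_n) (one : 'I_n) (inv : 'I_n -> 'I_n).

(* The axioms are arguments so that the group structure can be found by
   unification; similarly for [alg_ring] below. *)
Definition table_group (_ : associative mul) (_ : left_id one mul)
  (_ : left_inverse one inv mul) : Type := 'I_n.

Variables (mulA : associative mul) (mul1 : left_id one mul).
Variable mulV : left_inverse one inv mul.

HB.instance Definition _ := Finite.copy (table_group mulA mul1 mulV) 'I_n.
HB.instance Definition _ := Finite_isGroup.Build (table_group mulA mul1 mulV) mulA mul1 mulV.

End TableGroup.

Lemma table_cyclic_splitting (n p N : nat) (mul : 'I_n -> 'I_n -> 'I_n) (one : 'I_n) :
  prime p -> associative mul -> left_id one mul -> commutative mul ->
  (forall a, iter (p ^ N) (mul a) one = one) ->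
  exists e (H : finType) (act : H -> 'I_n -> H) (alpha : 'I_n -> 'I_(p ^ e)) pw (t0 : H),
    (forall a, iter (p ^ e) (mul a) one = one) /\ cyclic_splitting mul one act alpha pw.
Proof.
move=> p_pr mulA mul1 mulC exp_pN.
pose inv a := iter (p ^ N).-1 (mul a) one.
have mulV : left_inverse one inv mul.
  by move=> a; rewrite mulC -iterS prednK ?expn_gt0 ?prime_gt0.
pose gT : finGroupType := table_group mulA mul1 mulV.
have expE (a : gT) k : (a ^+ k)%g = iter k (mul a) one.
  by elim: k => // k IHk; rewrite expgS IHk.
have [|a|e [H [act [alpha [pw [t0 [exp_e H_split]]]]]]] :=
  @abelian_p_cyclic_splitting gT p N p_pr.
- exact: mulC.
- by rewrite expE exp_pN.
by exists e, H, act, alpha, pw, t0; split=> // a; rewrite -expE.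
Qed.

Lemma cyclic_splitting_card n q mul one (H : finType) act alpha pw :
  @cyclic_splitting 'I_n q mul one H act alpha pw -> 0 < #|H| -> #|H| * q = n.
Proof.
move=> H_split /card_gt0P[t0 _].
pose h (c : 'I_n) := (act t0 c, alpha c).
have h_inj : injective h.
  move=> c c' [hc ac]; have [d [_ d_uniq]] := split_unique H_split t0 (act t0 c') (alpha c').
  by rewrite (d_uniq c) // (d_uniq c').
have h_surj : codom h =i {: H * 'I_q}.
  move=> [t a]; rewrite [RHS]inE; apply/codomP.
  by have [c [[ct ca] _]] := split_unique H_split t0 t a; exists c; rewrite /h ct ca.
by have := card_codom h_inj; rewrite (eq_card h_surj) card_prod !card_ord.
Qed.

Import GRing.Theory.
Local Open Scope ring_scope.

(** * Towers of cyclic extensions of degree p *)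

Section SubringPred.
Variable R : pzRingType.

Definition subring_pred (S : R -> Prop) : Prop :=
  [/\ S 1, forall x y, S x -> S y -> S (x - y) & forall x y, S x -> S y -> S (x * y)].

Variable S : R -> Prop.
Hypothesis S_ring : subring_pred S.

Lemma subring_pred1 : S 1. Proof. by case: S_ring. Qed.

Lemma subring_predB x y : S x -> S y -> S (x - y).
Proof. by case: S_ring => _ + _; apply. Qed.

Lemma subring_predM x y : S x -> S y -> S (x * y).
Proof. by case: S_ring => _ _; apply. Qed.

Lemma subring_pred0 : S 0.
Proof. by rewrite -(subrr 1); apply: subring_predB; exact: subring_pred1. Qed.

Lemma subring_predN x : S x -> S (- x).
Proof. by rewrite -sub0r; apply: subring_predB; exact: subring_pred0. Qed.

Lemma subring_predD x y : S x -> S y -> S (x + y).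
Proof. by move=> Sx /subring_predN; rewrite -{2}(opprK y); exact: subring_predB. Qed.

Lemma subring_pred_sum I (r : seq I) (P : pred I) (F : I -> R) :
  (forall i, P i -> S (F i)) -> S (\sum_(i <- r | P i) F i).
Proof.
move=> SF; apply: (big_ind S) => //; [exact: subring_pred0|exact: subring_predD].
Qed.

Lemma subring_predX x n : S x -> S (x ^+ n).
Proof.
move=> Sx; elim: n => [|n IHn]; first by rewrite expr0; exact: subring_pred1.
by rewrite exprS; exact: subring_predM.
Qed.

End SubringPred.

Section CyclicTrace.
Variable A : comNzRingType.

Definition cyclic_trace (f : A -> A) (r : nat) (x : A) : A := \sum_(j < r) iter j f x.

Lemma iter_rmorph_is_zmod_morphism (f : {rmorphism A -> A}) r :
  zmod_morphism (fun x => iter r f x).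
Proof. by move=> x y; elim: r => //= r ->; rewrite rmorphB. Qed.

Lemma iter_rmorph_is_monoid_morphism (f : {rmorphism A -> A}) r :
  monoid_morphism (fun x => iter r f x).
Proof.
split; first by elim: r => //= r ->; rewrite rmorph1.
by move=> x y; elim: r => //= r ->; rewrite rmorphM.
Qed.

Definition iter_morph (f : A -> A) r x := iter r f x.

HB.instance Definition _ (f : {rmorphism A -> A}) r :=
  GRing.isZmodMorphism.Build A A (iter_morph f r) (iter_rmorph_is_zmod_morphism f r).
HB.instance Definition _ (f : {rmorphism A -> A}) r :=
  GRing.isMonoidMorphism.Build A A (iter_morph f r) (iter_rmorph_is_monoid_morphism f r).

Lemma cyclic_traceM (f : A -> A) r s x :
  cyclic_trace f (r * s) x = \sum_(j < s) \sum_(l < r) iter (r * j + l) f x.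
Proof.
rewrite /cyclic_trace; elim: s => [|s IHs]; first by rewrite muln0 !big_ord0.
rewrite mulnS addnC big_split_ord /= IHs big_ord_recr /=; congr (_ + _).
Qed.

Variable sigma : {rmorphism A -> A}.

Lemma iter_iter_morph r j y : iter j (iter_morph sigma r) y = iter_morph sigma (r * j) y.
Proof.
rewrite mulnC /iter_morph; elim: j => // j IHj.
by rewrite mulSn iterD -IHj.
Qed.

Lemma cyclic_traceMl r s x :
  cyclic_trace sigma (r * s) x
  = cyclic_trace (iter_morph sigma r) s (cyclic_trace sigma r x).
Proof.
rewrite cyclic_traceM; apply: eq_bigr => j _; rewrite iter_iter_morph.
by rewrite rmorph_sum; apply: eq_bigr => l _; rewrite /iter_morph iterD.
Qed.

Lemma cyclic_traceMr r s x :
  cyclic_trace sigma (r * s) x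
  = cyclic_trace sigma r (cyclic_trace (iter_morph sigma r) s x).
Proof.
rewrite cyclic_traceM exchange_big; apply: eq_bigr => l _ /=.
rewrite -[iter l _ _]/(iter_morph sigma l _) rmorph_sum; apply: eq_bigr => j _.
by rewrite iter_iter_morph addnC /iter_morph iterD.
Qed.

Definition hilbert90 r theta gamma : A :=
  - \sum_(j < r) cyclic_trace sigma j gamma * iter j sigma theta.

Lemma hilbert90P r theta gamma :
  cyclic_trace sigma r theta = 1 -> cyclic_trace sigma r gamma = 0 ->
  sigma (hilbert90 r theta gamma) - hilbert90 r theta gamma = gamma.
Proof.
move=> tr1 tr0; rewrite /hilbert90.
set S := fun j => cyclic_trace sigma j gamma.
have sS j : sigma (S j) = S j.+1 - gamma.
  rewrite /S /cyclic_trace rmorph_sum big_ord_recl /= addrC addKr.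
  exact: eq_bigr.
have S0 : S 0%N = 0 by rewrite /S /cyclic_trace big_ord0.
have tr1' : \sum_(j < r) iter j.+1 sigma theta = 1.
  by rewrite -[RHS](rmorph1 sigma) -tr1 rmorph_sum.
have shift : \sum_(j < r) S j.+1 * iter j.+1 sigma theta
             = \sum_(j < r) S j * iter j sigma theta.
  transitivity (\sum_(j < r.+1) S j * iter j sigma theta).
    by rewrite big_ord_recl S0 mul0r add0r.
  by rewrite big_ord_recr /= [S r]tr0 mul0r addr0.
rewrite rmorphN rmorph_sum opprK.
under eq_bigr => j _ do rewrite rmorphM /= sS mulrBl.
rewrite sumrB shift -mulr_sumr.
by rewrite [X in gamma * X]tr1' mulr1 opprB subrK.
Qed.

Lemma hilbert90_in (S : A -> Prop) r theta gamma :
  subring_pred S -> (forall x, S x -> S (sigma x)) ->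
  S theta -> S gamma -> S (hilbert90 r theta gamma).
Proof.
move=> Sring Ssig Sth Sga.
have Sit j x : S x -> S (iter j sigma x) by move=> Sx; elim: j => //= j; exact: Ssig.
apply: subring_predN => //; apply: subring_pred_sum => // j _.
apply: subring_predM => //; last exact: Sit.
by apply: subring_pred_sum => // l _; exact: Sit.
Qed.

End CyclicTrace.

Section PolyShift.
Variables (K : fieldType) (A : comAlgType K).

Lemma size_poly_shifted_roots (P : {poly A}) (x : A) (cs : seq K) :
  uniq cs -> (forall c, c \in cs -> P.[x + c%:A] = 0) -> P != 0 ->
  (size cs < size P)%N.
Proof.
elim: cs P => [|c cs IHcs] P; first by rewrite size_poly_gt0.
move=> /= /andP[c_cs cs_uniq] P0 Pneq0.
have /factor_theorem[Q defP] : root P (x + c%:A).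
  by apply/rootP/P0; rewrite inE eqxx.
have Qneq0 : Q != 0 by apply: contra_neq Pneq0; rewrite defP => ->; rewrite mul0r.
rewrite defP size_Mmonic ?monicXsubC // size_XsubC addn2 /= ltnS.
apply: IHcs => // d d_cs.
have /P0 : d \in c :: cs by rewrite inE d_cs orbT.
rewrite defP hornerM hornerXsubC opprD addrACA subrr add0r -scalerBl -scalerAr mulr1.
move=> /(congr1 (fun y => (d - c)^-1 *: y)); rewrite scaler0 scalerK //.
by rewrite subr_eq0; apply: contraNneq c_cs => <-.
Qed.

Variable p : nat.
Hypothesis pchar_K : p \in [pchar K].

Let p_pr : prime p. Proof. exact: pcharf_prime pchar_K. Qed.

Lemma natr_pchar_uniq : uniq [seq k%:R : K | k <- iota 0 p].
Proof.
rewrite map_inj_in_uniq ?iota_uniq // => i j.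
rewrite !mem_iota /= !add0n => ip jp.
wlog ij : i j ip jp / (i <= j)%N.
  by move=> W eij; case/orP: (leq_total i j) => ?; [apply: W|apply/esym/W].
move=> /eqP; rewrite eq_sym -subr_eq0 -natrB // -(dvdn_pcharf pchar_K).
move=> /eqnP; rewrite modn_small => [/eqP|]; last by rewrite ltn_subLR // ltn_addl.
by rewrite subn_eq0 => ji; apply/eqP; rewrite eqn_leq ij.
Qed.

Lemma sum_shift_expr_pchar (x : A) : \sum_(k < p) (x + k%:R) ^+ p.-1 = -1.
Proof.
have p_gt0 := prime_gt0 p_pr; have p_gt1 := prime_gt1 p_pr.
pose P : {poly K} := \sum_(k < p) ('X + k%:R%:P) ^+ p.-1.
have hP (c : K) : P.[c] = \sum_(k < p) (c + k%:R) ^+ p.-1.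
  by rewrite horner_sum; apply: eq_bigr => k _; rewrite !hornerE.
have PS (c : K) : P.[c + 1] = P.[c].
  rewrite !hP; pose F k := (c + k%:R) ^+ p.-1.
  have Fp : F p = F 0%N by rewrite /F (pcharf0 pchar_K).
  transitivity (\sum_(k < p) F k.+1).
    by apply: eq_bigr => k _; rewrite /F -addrA nat1r.
  apply: (addrI (F 0%N)); rewrite -(big_ord_recl p (fun k => F k)) big_ord_recr /=.
  by rewrite Fp addrC.
have P0 : P.[0] = -1.
  rewrite hP (bigD1 (Ordinal p_gt0)) //= addr0 expr0n.
  rewrite (_ : (p.-1 == 0%N) = false) ?add0r; last by case: (p) p_gt1 => [|[]].
  rewrite (eq_bigr (fun=> 1)) => [|k kn0].
    rewrite sumr_const cardC1 card_ord -[LHS](addrK 1) natr1 prednK //.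
    by rewrite (pcharf0 pchar_K) sub0r.
  rewrite add0r; have {}kn0 : (k%:R : K) != 0.
    by rewrite -(dvdn_pcharf pchar_K) gtnNdvd // lt0n.
  apply: (mulfI kn0); rewrite -exprS prednK // mulr1 -natrX.
  rewrite -(GRing.natr_mod_pchar pchar_K) fermat_little //.
  by rewrite GRing.natr_mod_pchar.
(* [P + 1] has degree less than [p] and vanishes on the prime field. *)
have defP : P + 1 = 0.
  apply: contraTeq isT => D0.
  have /(max_poly_roots D0) : all (root (P + 1)) [seq k%:R : K | k <- iota 0 p].
    apply/allP => _ /mapP[k _ ->]; apply/rootP; rewrite hornerD hornerC.
    suff -> : P.[k%:R] = -1 by rewrite addNr.
    by elim: k => // k IHk; rewrite -natr1 PS.
  move=> /(_ natr_pchar_uniq); rewrite size_map size_iota ltnNge => /negP[].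
  rewrite (leq_trans (size_polyD _ _)) // geq_max size_poly1 p_gt0 andbT.
  rewrite (leq_trans (size_sum _ _ _)) //; apply/bigmax_leqP => k _.
  rewrite (leq_trans (size_poly_exp_leq _ _)) // size_XaddC mul1n.
  by rewrite prednK.
have : horner_alg x (P + 1) = 0 by rewrite defP rmorph0.
rewrite rmorphD rmorph1 => /eqP; rewrite addr_eq0 => /eqP <-.
rewrite rmorph_sum; apply: eq_bigr => k _.
by rewrite rmorphXn rmorphD /= horner_algX horner_algC scaler_nat.
Qed.

End PolyShift.

Section CyclicTower.
Variables (p : nat) (K : fieldType) (A : comAlgType K) (sigma : {lrmorphism A -> A}).
Hypothesis pchar_K : p \in [pchar K].

Let p_pr : prime p. Proof. exact: pcharf_prime pchar_K. Qed.

Definition span_over (L : K -> Prop) (I : finType) (b : I -> A) (u : A) : Prop :=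
  exists2 c : I -> K, forall J, L (c J) & u = \sum_J c J *: b J.

Definition free_family (I : finType) (b : I -> A) : Prop :=
  forall c : I -> K, \sum_J c J *: b J = 0 -> forall J, c J = 0.

Record tower_stage i (a : seq K) (I : finType) (b : I -> A) (theta : A) : Prop :=
  TowerStage {
    stage_card : #|I| = (p ^ i)%N;
    stage_size : size a = i;
    stage_ring : forall L, subring_pred L -> (forall c, c \in a -> L c) ->
      subring_pred (span_over L b);
    stage_sigma : forall L, subring_pred L -> (forall c, c \in a -> L c) ->
      forall u, span_over L b u -> span_over L b (sigma u);
    stage_theta : forall L, subring_pred L -> (forall c, c \in a -> L c) ->
      span_over L b theta;
    stage_fixed : forall J, iter (p ^ i) sigma (b J) = b J;
    stage_free : free_family b;
    stage_trace : cyclic_trace sigma (p ^ i) theta = 1 }.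

Lemma iter_morph_scalable r : scalable (iter_morph sigma r).
Proof.
by rewrite /iter_morph => c u; elim: r => //= r ->; rewrite linearZ.
Qed.

Definition poly_in (S : A -> Prop) (x u : A) : Prop :=
  exists2 P : {poly A}, forall j, S P`_j & u = P.[x].

Section PolyIn.
Variables (S : A -> Prop) (x : A).
Hypothesis S_ring : subring_pred S.

Lemma poly_in_ring : subring_pred (poly_in S x).
Proof.
split.
- exists 1; last by rewrite hornerC.
  move=> j; rewrite coef1; case: eqP => _; first exact: subring_pred1.
  exact: subring_pred0.
- move=> _ _ [P SP ->] [Q SQ ->]; exists (P - Q); last by rewrite !hornerE.
  by move=> j; rewrite coefB; exact: subring_predB.
- move=> _ _ [P SP ->] [Q SQ ->]; exists (P * Q); last by rewrite hornerM.
  move=> j; rewrite coefM; apply: subring_pred_sum => // l _.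
  exact: subring_predM.
Qed.

Lemma poly_inC u : S u -> poly_in S x u.
Proof.
move=> Su; exists u%:P; last by rewrite hornerC.
by move=> j; rewrite coefC; case: eqP => // _; exact: subring_pred0.
Qed.

Lemma poly_inX : poly_in S x x.
Proof.
exists 'X; last by rewrite hornerX.
move=> j; rewrite coefX; case: eqP => _; first exact: subring_pred1.
exact: subring_pred0.
Qed.

Lemma poly_in_sigma :
  (forall u, S u -> S (sigma u)) -> S (sigma x - x) ->
  forall u, poly_in S x u -> poly_in S x (sigma u).
Proof.
move=> Ssig Sx u [P SP ->].
rewrite horner_coef rmorph_sum; apply: subring_pred_sum; first exact: poly_in_ring.
move=> j _; rewrite rmorphM rmorphXn /=; apply: subring_predM; first exact: poly_in_ring.
  exact/poly_inC/Ssig.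
apply: subring_predX; first exact: poly_in_ring.
rewrite -(subrK x (sigma x)); apply: subring_predD; first exact: poly_in_ring.
  exact: poly_inC.
exact: poly_inX.
Qed.

Lemma poly_in_small u : S (x ^+ p - x) -> poly_in S x u ->
  exists P : {poly A}, [/\ forall j, S P`_j, (size P <= p)%N & u = P.[x]].
Proof.
set al := x ^+ p - x => Sal [P + ->]; have p_gt1 := prime_gt1 p_pr.
elim/poly_ind: P => [|P c IHP] SP.
  by exists 0; split; rewrite ?size_poly0 // => j; rewrite coef0; exact: subring_pred0.
have Sc : S c by have := SP 0%N; rewrite coefD coefMX coefC eqxx add0r.
rewrite hornerMXaddC; have {IHP}[|R [SR sR ->]] := IHP.
  by move=> j; have := SP j.+1; rewrite coefD coefMX coefC addr0.
pose r := R`_p.-1.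
have Sr : S r by exact: SR.
exists (R * 'X + c%:P - r%:P * ('X^p - 'X - al%:P)); split.
- move=> j; rewrite !coefE; apply: subring_predB => //.
    apply: subring_predD => //; first by case: eqP => _; [exact: subring_pred0|].
    by case: eqP => // _; exact: subring_pred0.
  apply: subring_predM => //; apply: subring_predB => //; last first.
    by case: eqP => // _; exact: subring_pred0.
  by apply: subring_predB => //; case: eqP => _;
    rewrite ?mulr0n ?mulr1n; do [exact: subring_pred0|exact: subring_pred1].
- apply/leq_sizeP => j pj; rewrite !coefE.
  have j1 : (1 < j)%N by exact: leq_trans pj.
  rewrite (gtn_eqF j1) (gtn_eqF (ltnW j1)) !subr0 addr0.
  move: pj; rewrite leq_eqVlt => /orP[/eqP<-|pj].
    by rewrite eqxx mulr1 subrr.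
  rewrite (gtn_eqF pj) mulr0 subr0 (leq_sizeP _ _ sR) //.
  by rewrite -ltnS prednK // ltnW.
- rewrite !hornerE.
  have -> : x ^+ p - x - al = 0 by rewrite subrr.
  by rewrite mulr0 subr0.
Qed.

End PolyIn.

Lemma tower_stage0 : tower_stage 0 [::] (fun _ : unit => 1) 1.
Proof.
have span1 L (u : A) : subring_pred L ->
    span_over L (fun _ : unit => 1) u <-> (exists2 c, L c & u = c%:A).
  move=> _; split=> [[c Lc ->]|[c Lc ->]].
    by exists (c tt) => //; rewrite (big_pred1 tt) // => -[].
  by exists (fun=> c) => //; rewrite (big_pred1 tt) // => -[].
split=> //.
- by rewrite card_unit.
- move=> L Lring _; split.
  + by apply/span1 => //; exists 1; [exact: subring_pred1|rewrite scale1r].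
  + move=> _ _ /span1[//|c Lc ->] /span1[//|d Ld ->]; apply/span1 => //.
    by exists (c - d); [exact: subring_predB|rewrite scalerBl].
  + move=> _ _ /span1[//|c Lc ->] /span1[//|d Ld ->]; apply/span1 => //.
    by exists (c * d); [exact: subring_predM|rewrite -scalerAl mul1r scalerA].
- move=> L Lring _ _ /span1[//|c Lc ->]; apply/span1 => //.
  by exists c => //; rewrite linearZ rmorph1.
- move=> L Lring _; apply/span1 => //.
  by exists 1; [exact: subring_pred1|rewrite scale1r].
- by move=> _; rewrite /= rmorph1.
- move=> c; rewrite (big_pred1 tt) => [/eqP|[]//].
  by rewrite scaler_eq0 oner_eq0 orbF => /eqP c0 [].
- by rewrite /cyclic_trace big_ord1.
Qed.

Variables (n : nat) (theta0 : A).
Hypothesis trace_theta0 : cyclic_trace sigma (p ^ n) theta0 = 1.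
Hypothesis sigma_fixed : forall x, sigma x = x -> exists c, x = c%:A.

Let pchar_A : p \in [pchar A]. Proof. by rewrite pchar_lalg. Qed.

(* [x] is first chosen with [tau x = x + 1] for [tau = sigma^(p^i)], by means of
   the element [theta0] of trace 1; as [sigma x - x] and [theta] have the same
   trace, [x] can be corrected by a [tau]-invariant element. *)
Lemma tower_generator i theta : (i < n)%N ->
  cyclic_trace sigma (p ^ i) theta = 1 -> iter (p ^ i) sigma theta = theta ->
  exists x, iter (p ^ i) sigma x = x + 1 /\ sigma x = x + theta.
Proof.
move=> lin tr_th th_fix; set r := (p ^ i)%N in tr_th th_fix *.
pose tau : {rmorphism A -> A} := iter_morph sigma r.
have defpn : (p ^ n)%N = (r * p ^ (n - i))%N by rewrite -expnD subnKC // ltnW.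
have [x0 tau_x0] : exists x0, tau x0 = x0 + 1.
  exists (hilbert90 tau (p ^ (n - i)) (cyclic_trace sigma r theta0) 1).
  rewrite -[X in _ = _ + X](@hilbert90P _ tau (p ^ (n - i)) (cyclic_trace sigma r theta0) 1).
  - by rewrite addrC subrK.
  - by rewrite -cyclic_traceMl -defpn.
  rewrite /cyclic_trace (eq_bigr (fun=> 1)) => [|j _].
    rewrite sumr_const card_ord natrX (pcharf0 pchar_A) expr0n.
    by rewrite (_ : (n - i == 0)%N = false) // subn_eq0 leqNgt lin.
  by rewrite iter_iter_morph rmorph1.
have tau_sigma u : tau (sigma u) = sigma (tau u) by exact: esym (iterSr r sigma u).
pose gam := theta - (sigma x0 - x0).
have gam_fix : tau gam = gam.
  rewrite /gam !rmorphB /= tau_sigma tau_x0 rmorphD rmorph1 [tau theta]th_fix.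
  by rewrite [iter_morph sigma r x0]tau_x0; congr (_ - _); rewrite opprD addrACA subrr addr0.
have tr_gam : cyclic_trace sigma r gam = 0.
  have -> : cyclic_trace sigma r gam
            = cyclic_trace sigma r theta - \sum_(j < r) (iter j.+1 sigma x0 - iter j sigma x0).
    rewrite /cyclic_trace -sumrB; apply: eq_bigr => j _.
    rewrite -[LHS]/(iter_morph sigma j gam) !rmorphB /=; congr (_ - (_ - _)).
  exact: esym (iterSr j sigma x0).
  rewrite tr_th -(big_mkord xpredT (fun j => iter j.+1 sigma x0 - iter j sigma x0)).
  rewrite telescope_sumr //= -[iter r sigma x0]/(tau x0) tau_x0.
  by rewrite addrAC subrr add0r subrr.
pose y := hilbert90 sigma r theta gam.
have tau_y : tau y = y.
  apply: (@hilbert90_in _ sigma (fun u => tau u = u)) => //.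
    split=> [|u v fu fv|u v fu fv]; first by rewrite rmorph1.
      by rewrite rmorphB /= fu fv.
    by rewrite rmorphM /= fu fv.
  by move=> u fu; rewrite tau_sigma fu.
exists (x0 + y); split.
  by rewrite -[LHS]/(tau (x0 + y)) rmorphD /= tau_x0 tau_y addrAC.
have sigma_y : sigma y = gam + y by rewrite -[X in X + _](hilbert90P tr_th tr_gam) subrK.
by rewrite rmorphD /= sigma_y /gam; ring.
Qed.

Lemma span_overZ (L : K -> Prop) (I : finType) (b : I -> A) c u :
  subring_pred L -> L c -> span_over L b u -> span_over L b (c *: u).
Proof.
move=> Lring Lc [d Ld ->]; exists (fun J => c * d J).
  by move=> J; exact: subring_predM.
by rewrite scaler_sumr; apply: eq_bigr => J _; rewrite scalerA.
Qed.

Lemma span_over_mem (L : K -> Prop) (I : finType) (b : I -> A) J :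
  subring_pred L -> span_over L b (b J).
Proof.
move=> Lring; exists (fun J' => (J' == J)%:R).
  move=> J'; case: eqP => _; first exact: subring_pred1.
  exact: subring_pred0.
rewrite (bigD1 J) //= eqxx scale1r big1 ?addr0 // => J' /negPf->.
by rewrite scale0r.
Qed.

(* Albert's extension step: [al0] in the previous stage satisfies
   [sigma al0 - al0 = sigma (x^p - x) - (x^p - x)], so [x^p - x - al0] is a scalar
   [a0], the only new constant.  The next element of trace 1 is
   [- x^(p-1) theta], because [sum_(k < p) (x + k)^(p-1) = -1]. *)
Lemma tower_step i a (I : finType) (b : I -> A) theta : (i < n)%N ->
  tower_stage i a b theta ->
  exists a' (I' : finType) (b' : I' -> A) theta', tower_stage i.+1 a' b' theta'.
Proof.
move=> lin [card_I size_a ringP sigmaP thetaP fixP freeP trP].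
have p_gt1 := prime_gt1 p_pr; have p_gt0 := prime_gt0 p_pr.
pose Lfull := fun _ : K => True.
have Lfull_ring : subring_pred Lfull by [].
pose tau : {rmorphism A -> A} := iter_morph sigma (p ^ i).
have span_fix L u : span_over L b u -> tau u = u.
  case=> c _ ->; rewrite rmorph_sum; apply: eq_bigr => J _.
  by rewrite [LHS]iter_morph_scalable; congr (_ *: _); exact: fixP.
have [x [tau_x sigma_x]] : exists x, tau x = x + 1 /\ sigma x = x + theta.
  by apply: tower_generator => //; apply: (span_fix Lfull); exact: thetaP.
have tau_xk k : iter k tau x = x + k%:R.
  elim: k => [|k IHk]; first by rewrite addr0.
  by rewrite iterS IHk rmorphD rmorph_nat tau_x -addrA nat1r.
pose gam := theta ^+ p - theta.
have tr_gam : cyclic_trace sigma (p ^ i) gam = 0.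
  have -> : cyclic_trace sigma (p ^ i) gam
      = (cyclic_trace sigma (p ^ i) theta) ^+ p - cyclic_trace sigma (p ^ i) theta.
    rewrite -[X in X - _]/(pFrobenius_aut pchar_A _) rmorph_sum -sumrB.
    apply: eq_bigr => j _.
    by rewrite -[LHS]/(iter_morph sigma j gam) rmorphB rmorphXn.
  by rewrite trP expr1n subrr.
pose al0 := hilbert90 sigma (p ^ i) theta gam.
have [a0 def_a0] : exists a0, x ^+ p - x - al0 = a0%:A.
  apply: sigma_fixed; apply/eqP; rewrite -subr_eq0.
  have sigma_al0 : sigma al0 = gam + al0 by rewrite -[X in X + _](hilbert90P trP tr_gam) subrK.
  have pow_x : (x + theta) ^+ p = x ^+ p + theta ^+ p.
    by rewrite -!(pFrobenius_autE pchar_A) rmorphD.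
  rewrite !rmorphB rmorphXn /= sigma_al0 sigma_x pow_x /gam.
  by apply/eqP; ring.
pose b' (jJ : 'I_p * I) := b jJ.2 * x ^+ jJ.1.
exists (a0 :: a), ('I_p * I)%type, b', (- (x ^+ p.-1 * theta)).
have Sring L : subring_pred L -> (forall c, c \in a0 :: a -> L c) ->
    subring_pred (span_over L b).
  by move=> Lring La; apply: ringP => // c ca; apply: La; rewrite inE ca orbT.
have span_poly L : subring_pred L -> (forall c, c \in a0 :: a -> L c) ->
    forall u, span_over L b' u <-> poly_in (span_over L b) x u.
  move=> Lring La u; have S_ring := Sring L Lring La.
  have P_ring := poly_in_ring x S_ring; split.
    case=> c Lc ->; apply: subring_pred_sum => // -[j J] _; rewrite /b' /=.
    rewrite scalerAl; apply: subring_predM => //.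
      by apply: poly_inC => //; apply: span_overZ => //; exact: span_over_mem.
    by apply: subring_predX => //; exact: poly_inX.
  move=> Pu; have S_x : span_over L b (x ^+ p - x).
    have -> : x ^+ p - x = al0 + a0%:A by rewrite -def_a0 addrCA subrr addr0.
    apply: subring_predD => //.
      apply: hilbert90_in => //.
      - by apply: sigmaP => // c ca; apply: La; rewrite inE ca orbT.
      - by apply: thetaP => // c ca; apply: La; rewrite inE ca orbT.
      - have th : span_over L b theta.
          by apply: thetaP => // c ca; apply: La; rewrite inE ca orbT.
        by apply: subring_predB => //; exact: subring_predX.
    by apply: span_overZ => //; [apply: La; rewrite inE eqxx|exact: subring_pred1].
  have [P [SP sP ->]] := poly_in_small S_ring S_x Pu.
  have /choice[c cP] : forall j, exists c : I -> K,
      (forall J, L (c J)) /\ P`_j = \sum_J c J *: b J.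
    by move=> j; have [c] := SP j; exists c.
  exists (fun jJ : 'I_p * I => c jJ.1 jJ.2); first by move=> [j J]; exact: (cP j).1.
  rewrite (horner_coef_wide _ sP) -(pair_bigA _ (fun (j : 'I_p) J => c j J *: b' (j, J))) /=.
  apply: eq_bigr => j _; rewrite (cP j).2 mulr_suml.
  by apply: eq_bigr => J _; rewrite scalerAl.
split.
- by rewrite card_prod card_ord card_I expnS.
- by rewrite /= size_a.
- move=> L Lring La; have P_ring := poly_in_ring x (Sring L Lring La).
  have spP := span_poly L Lring La.
  split; first by apply/spP; exact: subring_pred1.
    by move=> u v /spP Pu /spP Pv; apply/spP; exact: subring_predB.
  by move=> u v /spP Pu /spP Pv; apply/spP; exact: subring_predM.
- move=> L Lring La u /(span_poly L Lring La) Pu; apply/(span_poly L Lring La).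
  apply: poly_in_sigma => //; first exact: Sring.
    by apply: sigmaP => // c ca; apply: La; rewrite inE ca orbT.
  have -> : sigma x - x = theta by rewrite sigma_x addrC addKr.
  by apply: thetaP => // c ca; apply: La; rewrite inE ca orbT.
- move=> L Lring La; apply/(span_poly L Lring La).
  have S_ring := Sring L Lring La; have P_ring := poly_in_ring x S_ring.
  apply: subring_predN => //; apply: subring_predM => //.
    by apply: subring_predX => //; exact: poly_inX.
  by apply: poly_inC => //; apply: thetaP => // c ca; apply: La; rewrite inE ca orbT.
- move=> [j J]; rewrite expnSr -[LHS]/(iter_morph sigma _ _) -iter_iter_morph.
  rewrite -[iter p _ _]/(iter_morph tau p (b' (j, J))) rmorphM rmorphXn /=.
  congr (_ * _ ^+ _).
    by apply: iter_fix; exact: fixP.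
  by rewrite [LHS]tau_xk (pcharf0 pchar_A) addr0.
- move=> c c0; pose u (j : 'I_p) := \sum_J c (j, J) *: b J.
  have u_fix (j : 'I_p) : tau (u j) = u j by apply: (span_fix Lfull); exists (fun J => c (j, J)).
  pose P : {poly A} := \sum_(j < p) u j *: 'X^j.
  have coefP k : P`_k = if insub k is Some j then u j else 0.
    rewrite /P coef_sum; case: insubP => [j _ <-|].
      rewrite (bigD1 j) //= coefZ coefXn eqxx mulr1 big1 ?addr0 // => l lj.
      by rewrite coefZ coefXn eq_sym val_eqE (negPf lj) mulr0.
    rewrite -leqNgt => pk; rewrite big1 // => l _.
    by rewrite coefZ coefXn gtn_eqF ?mulr0 // (leq_trans _ pk).
  have P0 : P = 0.
    apply: contraTeq isT => Pn0.
    suff Px c' : c' \in [seq k%:R : K | k <- iota 0 p] -> P.[x + c'%:A] = 0.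
      have := size_poly_shifted_roots (natr_pchar_uniq pchar_K) Px Pn0.
      rewrite size_map size_iota ltnNge => /negP[]; apply/leq_sizeP => k pk.
      by rewrite coefP insubN // -leqNgt.
    move=> /mapP[k _ ->].
    have mapP : map_poly tau P = P.
      apply/polyP => l; rewrite coef_map coefP.
      by case: insubP => [j _ _|_] /=; [exact: u_fix|exact: rmorph0].
    elim: k => [|k IHk]; last first.
      have := congr1 tau IHk; rewrite rmorph0 -horner_map mapP rmorphD /= tau_x.
      have -> : tau k%:R%:A = k%:R%:A by rewrite scaler_nat rmorph_nat.
      by rewrite -addrA -nat1r scalerDl scale1r.
    rewrite scale0r addr0 horner_sum.
    transitivity (\sum_(j < p) \sum_J c (j, J) *: b' (j, J)); last first.
      by rewrite pair_bigA -[RHS]c0; apply: eq_bigr => -[].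
    apply: eq_bigr => j _; rewrite hornerZ hornerXn mulr_suml.
    by apply: eq_bigr => J _; rewrite -scalerAl.
  move=> [j J]; apply: (freeP (fun J => c (j, J))).
  by have := coefP j; rewrite P0 coef0 valK.
- rewrite expnSr cyclic_traceMr -[RHS]trP; congr (cyclic_trace _ _ _).
  rewrite /cyclic_trace.
  transitivity (- \sum_(j < p) (x + j%:R) ^+ p.-1 * theta).
    rewrite -sumrN; apply: eq_bigr => j _.
    rewrite -[LHS]/(iter_morph tau j _) rmorphN rmorphM rmorphXn /=.
    congr (- (_ ^+ _ * _)); first exact: tau_xk.
    by apply: iter_fix; apply: (span_fix Lfull); exact: thetaP.
  by rewrite -mulr_suml (sum_shift_expr_pchar pchar_K) mulN1r opprK.
Qed.

Lemma cyclic_tower :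
  exists a (I : finType) (b : I -> A) theta, tower_stage n a b theta.
Proof.
suff H i : (i <= n)%N -> exists a (I : finType) (b : I -> A) theta, tower_stage i a b theta.
  exact: H.
elim: i => [_|i IHi lin]; first by exists [::], unit, (fun=> 1), 1; exact: tower_stage0.
have [a [I [b [theta st]]]] := IHi (ltnW lin).
exact: tower_step lin st.
Qed.

End CyclicTower.

(** * Subfields of bounded transcendence degree *)

Section Subfield.
Variables (K : fieldType) (D : K -> Prop).

Definition subfield_pred : Prop :=
  [/\ D 1, forall x y, D x -> D y -> D (x - y) & forall x y, D x -> D y -> D (x / y)].

Hypothesis D_field : subfield_pred.

Definition subfield_mem (_ : subfield_pred) : {pred K} := fun x => `[< D x >].

Lemma subfield_mem_divring : divring_closed (subfield_mem D_field).
Proof.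
case: D_field => D1 DB DM.
split=> [|x y /asboolP Dx /asboolP Dy|x y /asboolP Dx /asboolP Dy].
- exact/asboolP.
- exact/asboolP/DB.
- exact/asboolP/DM.
Qed.

HB.instance Definition _ := GRing.isDivringClosed.Build K (subfield_mem D_field)
  subfield_mem_divring.

Record subfield := Subfield {
  subfield_val : K; subfield_valP : subfield_val \in subfield_mem D_field }.

HB.instance Definition _ := [isSub for subfield_val].
HB.instance Definition _ := [Choice of subfield by <:].
HB.instance Definition _ := [SubChoice_isSubIntegralDomain of subfield by <:].
HB.instance Definition _ := [SubIntegralDomain_isSubField of subfield by <:].

End Subfield.

Section SubfieldLift.
Variables (K : fieldType) (D : K -> Prop) (D_field : subfield_pred D).

Lemma subfield_valD (x : subfield D_field) : D (val x).
Proof. exact/asboolP/subfield_valP. Qed.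

Variables (R : pzRingType) (f : {rmorphism R -> K}).

Definition subfield_lift (f_D : forall x, D (f x)) (x : R) : subfield D_field :=
  Subfield (introT (asboolP _) (f_D x)).

Hypothesis f_D : forall x, D (f x).

Lemma subfield_lift_zmod_morphism : zmod_morphism (subfield_lift f_D).
Proof. by move=> x y; apply: val_inj; rewrite /= rmorphB. Qed.

Lemma subfield_lift_monoid_morphism : monoid_morphism (subfield_lift f_D).
Proof. by split=> [|x y]; apply: val_inj; rewrite /= ?rmorph1 ?rmorphM. Qed.

HB.instance Definition _ := GRing.isZmodMorphism.Build R (subfield D_field)
  (subfield_lift f_D) subfield_lift_zmod_morphism.
HB.instance Definition _ := GRing.isMonoidMorphism.Build R (subfield D_field)
  (subfield_lift f_D) subfield_lift_monoid_morphism.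

End SubfieldLift.

Section SubfieldPred.
Variables (K : fieldType) (E : K -> Prop).
Hypothesis E_field : subfield_pred E.

Lemma subfield_predM x y : E x -> E y -> E (x * y).
Proof.
case: E_field => E1 _ Ediv Ex Ey.
by rewrite -(invrK y); apply: (Ediv) => //; rewrite -(mul1r y^-1); exact: Ediv.
Qed.

Lemma subfield_pred_subring : subring_pred E.
Proof. by case: E_field => E1 EB _; split=> //; exact: subfield_predM. Qed.

End SubfieldPred.

Lemma rmorph_mmap n (R : nzRingType) (S S' : comNzRingType) (g : {rmorphism S -> S'})
  (f : {rmorphism R -> S}) (h : 'I_n -> S) (P : {mpoly R[n]}) :
  g (mmap f h P) = mmap (g \o f) (g \o h) P.
Proof.
rewrite /mmap rmorph_sum; apply: eq_bigr => m _; rewrite rmorphM; congr (_ * _).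
by rewrite /mmap1 rmorph_prod; apply: eq_bigr => i _; rewrite rmorphXn.
Qed.

Lemma mmap_muni n (R S : comNzRingType) (f : {rmorphism R -> S}) (h : 'I_n.+1 -> S)
  (P : {mpoly R[n.+1]}) :
  mmap f h P = (map_poly (mmap f (fun l => h (widen_ord (leqnSn n) l))) (muni P)).[h ord_max].
Proof.
rewrite muniE rmorph_sum /= horner_sum; apply: eq_bigr => m _.
rewrite map_polyZ map_polyXn hornerZ hornerXn /= mmapZ mmapX -mulrA; congr (_ * _).
rewrite /mmap1 big_ord_recr /=; congr (_ * _).
by apply: eq_bigr => l _; rewrite mnmE.
Qed.

Section AlgebraicClosure.
Variables (F K : fieldType) (i : {rmorphism F -> K}).

Definition algebraic_over_mpoly n (t : 'I_n -> K) (x : K) : Prop :=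
  exists2 P : {poly {mpoly F[n]}},
    map_poly (mmap i t) P != 0 & root (map_poly (mmap i t) P) x.

Definition alg_closed_in (E : K -> Prop) : Prop :=
  forall (p : {poly K}) x, p != 0 -> root p x -> (forall l, E p`_l) -> E x.

Lemma subfield_mmap (E : K -> Prop) n (t : 'I_n -> K) P :
  subfield_pred E -> (forall c, E (i c)) -> (forall l, E (t l)) -> E (mmap i t P).
Proof.
move=> E_field Ei Et; have E_ring := subfield_pred_subring E_field.
apply: subring_pred_sum => // m _; apply: subring_predM => //.
rewrite /mmap1; apply: (big_ind E) => [|x y|l _].
- exact: subring_pred1.
- exact: subring_predM.
- exact: subring_predX.
Qed.

Lemma algebraic_over_mpoly_in (E : K -> Prop) n (t : 'I_n -> K) x :
  subfield_pred E -> alg_closed_in E -> (forall c, E (i c)) -> (forall l, E (t l)) ->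
  algebraic_over_mpoly t x -> E x.
Proof.
move=> E_field E_closed Ei Et [P Pn0 Px]; apply: (E_closed _ _ Pn0 Px) => l.
by rewrite coef_map; exact: subfield_mmap.
Qed.

Section Generators.
Variables (n : nat) (t : 'I_n -> K).

Definition frac_mmap (x : K) : Prop :=
  exists P Q, mmap i t Q != 0 /\ x = mmap i t P / mmap i t Q.

Lemma frac_mmap_field : subfield_pred frac_mmap.
Proof.
split.
- by exists 1, 1; rewrite rmorph1 oner_neq0 divr1.
- move=> _ _ [P [Q [Qn0 ->]]] [P' [Q' [Qn0' ->]]].
  exists (P * Q' - P' * Q), (Q * Q'); rewrite !(rmorphB, rmorphM) mulf_neq0 //; split=> //.
  by field; rewrite Qn0 Qn0'.
- move=> _ _ [P [Q [Qn0 ->]]] [P' [Q' [Qn0' ->]]].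
  have [P0'|Pn0'] := eqVneq (mmap i t P') 0.
    exists 0, 1; rewrite rmorph0 rmorph1 oner_neq0 P0'; split=> //.
    by rewrite !mul0r invr0 mulr0.
  exists (P * Q'), (Q * P'); rewrite !rmorphM mulf_neq0 //; split=> //.
  by field; rewrite Qn0 Qn0' Pn0'.
Qed.

Lemma frac_mmap_mmap P : frac_mmap (mmap i t P).
Proof. by exists P, 1; rewrite rmorph1 oner_neq0 divr1. Qed.

Definition alg_closure (x : K) : Prop :=
  integralOver (val : {rmorphism subfield frac_mmap_field -> K}) x.

Lemma alg_closure_field : subfield_pred alg_closure.
Proof.
split; first exact: integral1.
- by move=> x y; exact: integral_sub.
- by move=> x y; exact: integral_div.
Qed.

Lemma alg_closure_closed : alg_closed_in alg_closure.
Proof.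
move=> p x pn0 px pE; apply: (integral_root pn0 px) => y /(nthP 0)[l _ <-].
exact: pE.
Qed.

Lemma alg_closure_mmap P : alg_closure (mmap i t P).
Proof.
pose y : subfield frac_mmap_field := Subfield (introT (asboolP _) (frac_mmap_mmap P)).
by rewrite -[mmap i t P]/(val y); exact: integral_id.
Qed.

Lemma alg_closure_base c : alg_closure (i c).
Proof. by rewrite -(mmapC t); exact: alg_closure_mmap. Qed.

Lemma alg_closure_gen l : alg_closure (t l).
Proof. by rewrite -[t l](mmap1U t l) -(mmapX t i); exact: alg_closure_mmap. Qed.

Lemma common_denominator (R : nzRingType) (v : {rmorphism R -> K}) (p : {poly R}) :
  (forall c, frac_mmap (v c)) ->
  exists b P, mmap i t b != 0 /\ map_poly (mmap i t) P = mmap i t b *: map_poly v p.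
Proof.
move=> v_frac; elim/poly_ind: p => [|p c [b [P [bn0 defP]]]].
  by exists 1, 0; rewrite rmorph1 oner_neq0 !rmorph0 scaler0.
have [A [B [Bn0 defc]]] := v_frac c.
exists (b * B), (P * B%:P * 'X + (b * A)%:P); split.
  by rewrite rmorphM mulf_neq0.
have -> : map_poly v (p * 'X + c%:P)
          = map_poly v p * 'X + (mmap i t A)%:P * (mmap i t B)^-1%:P.
  by rewrite -polyCM -defc rmorphD rmorphM /= map_polyX map_polyC.
rewrite !(rmorphD, rmorphM) /= map_polyX !map_polyC /= defP -!mul_polyC !rmorphM /=.
have clear_den (m q d a d' X : {poly K}) :
    d * d' = 1 -> m * q * d * X + m * a = m * d * (q * X + a * d').
  by move=> dd'; rewrite -[X in _ + X]mulr1 -dd'; ring.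
by apply: clear_den; rewrite -polyCM divff.
Qed.

Lemma alg_closureP x : alg_closure x -> algebraic_over_mpoly t x.
Proof.
case=> p p_mon px; have [b [P [bn0 defP]]] := common_denominator p (@subfield_valD _ _ _).
exists P; rewrite defP; last by rewrite /root hornerZ (rootP px) mulr0.
by rewrite scaler_eq0 negb_or bn0 map_poly_eq0 monic_neq0.
Qed.

End Generators.

Lemma alg_independent_subset n (t : 'I_n -> K) :
  exists m (t' : 'I_m -> K), [/\ (m <= n)%N, injective (mmap i t') &
    forall l, alg_closure t' (t l)].
Proof.
elim: n t => [|n IHn] t.
  exists 0%N, t; split=> // [|[]//].
  move=> P Q; rewrite (nvar0_mpolyC P) (nvar0_mpolyC Q) !mmapC => PQ.
  by rewrite (fmorph_inj i PQ).
have [m [t' [lemn inj_t' t'P]]] := IHn (fun l => t (widen_ord (leqnSn n) l)).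
have cl_split (E : K -> Prop) : (forall l, E (t (widen_ord (leqnSn n) l))) ->
    E (t ord_max) -> forall l, E (t l).
  move=> E1 E2 l; case: (unliftP ord_max l) => [l' ->|-> //].
  by rewrite (_ : lift _ _ = widen_ord (leqnSn n) l') //;
     apply/val_inj; rewrite /= /bump leqNgt ltn_ord.
have [t_max|t_max] := pselect (alg_closure t' (t ord_max)).
  exists m, t'; split=> //; first exact: leqW.
  exact: cl_split.
pose u (l : 'I_m.+1) := if unlift ord_max l is Some l' then t' l' else t ord_max.
have u_max : u ord_max = t ord_max by rewrite /u unlift_none.
have u_widen l : u (widen_ord (leqnSn m) l) = t' l.
  rewrite /u (_ : widen_ord _ _ = lift ord_max l) ?liftK //.
  by apply/val_inj; rewrite /= /bump leqNgt ltn_ord.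
have u_fun : (fun l => u (widen_ord (leqnSn m) l)) = t' by apply/funext => l.
exists m.+1, u; split=> //.
  suff u_ker P : mmap i u P = 0 -> P = 0 by exact: raddf_inj.
  rewrite mmap_muni u_fun u_max => P0.
  have muni0 : muni P = 0.
    apply: contra_notP t_max => /eqP Pn0; apply/(algebraic_over_mpoly_in (t := t')).
    - exact: alg_closure_field.
    - exact: alg_closure_closed.
    - exact: alg_closure_base.
    - exact: alg_closure_gen.
    exists (muni P); last exact/rootP.
    by rewrite -(rmorph0 (map_poly (mmap i t'))) (inj_eq (map_inj_poly inj_t' _)) ?rmorph0.
  by rewrite -(comp_mpoly_id P) /comp_mpoly mmap_muni muni0 rmorph0 horner0.
have u_cl l : alg_closure u (t' l) by rewrite -u_widen; exact: alg_closure_gen.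
apply: cl_split => [l|]; last by rewrite -u_max; exact: alg_closure_gen.
apply: (algebraic_over_mpoly_in (t := t')).
- exact: alg_closure_field.
- exact: alg_closure_closed.
- exact: alg_closure_base.
- exact: u_cl.
exact/alg_closureP/t'P.
Qed.

Lemma trdeg_subfield n (t : 'I_n -> K) :
  exists (L : fieldType) (iL : {rmorphism F -> L}) (j : {rmorphism L -> K}) m,
    [/\ (m <= n)%N, j \o iL =1 i, has_trdeg iL m &
      forall x, algebraic_over_mpoly t x -> exists y, j y = x].
Proof.
have [m [t' [lemn inj_t' t'P]]] := alg_independent_subset t.
pose L := subfield (alg_closure_field t').
pose v : {rmorphism L -> K} := val.
pose iL : {rmorphism F -> L} := subfield_lift (alg_closure_field t') (@alg_closure_base m t').
exists L, iL, v, m; split=> //.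
  pose tL l : L := Subfield (introT (asboolP _) (alg_closure_gen t' l)).
  have v_mmap P : v (mmap iL tL P) = mmap i t' P by rewrite rmorph_mmap.
  exists tL; split=> [P Q PQ|x]; first by apply: inj_t'; rewrite -!v_mmap PQ.
  have [P Pn0 Px] := alg_closureP (subfield_valD x).
  have map_v : map_poly v (map_poly (mmap iL tL) P) = map_poly (mmap i t') P.
    by rewrite -map_poly_comp; apply: eq_map_poly => Q; exact: v_mmap.
  exists P; first by apply: contra_neq Pn0 => ->; rewrite rmorph0.
  by rewrite -(fmorph_root v) map_v.
move=> x x_alg.
suff Lx : alg_closure t' x by exists (Subfield (introT (asboolP _) Lx)).
apply: algebraic_over_mpoly_in x_alg => //.
- exact: alg_closure_field.
- exact: alg_closure_closed.
- exact: alg_closure_base.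
Qed.

End AlgebraicClosure.

(** * Algebras, comodules and torsors in coordinates *)

Section FinAlg.
Variables (F : fieldType) (n : nat) (A : fin_alg F n).
Implicit Types (u v w : 'rV[F]_n) (X : 'M[F]_n).

Lemma mul_tensor_is_linear : linear (mul_tensor A).
Proof.
move=> a X Y; rewrite /mul_tensor scaler_sumr -big_split; apply: eq_bigr => i _.
rewrite scaler_sumr -big_split; apply: eq_bigr => j _ /=.
by rewrite !mxE scalerDl scalerA.
Qed.

HB.instance Definition _ := GRing.isLinear.Build F 'M[F]_n 'rV[F]_n _
  (mul_tensor A) mul_tensor_is_linear.

Lemma mul_algDl u v w : mul_alg A (u + v) w = mul_alg A u w + mul_alg A v w.
Proof. by rewrite /mul_alg linearD mulmxDl linearD. Qed.

Lemma mul_algZl a u v : mul_alg A (a *: u) v = a *: mul_alg A u v.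
Proof. by rewrite /mul_alg linearZ -scalemxAl linearZ. Qed.

Lemma mul_algDr u v w : mul_alg A u (v + w) = mul_alg A u v + mul_alg A u w.
Proof. by rewrite /mul_alg mulmxDr linearD. Qed.

Lemma mul_algZr a u v : mul_alg A u (a *: v) = a *: mul_alg A u v.
Proof. by rewrite /mul_alg -scalemxAr linearZ. Qed.

Lemma mul_alg0l v : mul_alg A 0 v = 0.
Proof. by have := mul_algZl 0 0 v; rewrite !scale0r. Qed.

Lemma mul_alg0r v : mul_alg A v 0 = 0.
Proof. by have := mul_algZr 0 v 0; rewrite !scale0r. Qed.

Lemma mul_alg_sumr I (r : seq I) (P : pred I) (f : I -> 'rV_n) u :
  mul_alg A u (\sum_(i <- r | P i) f i) = \sum_(i <- r | P i) mul_alg A u (f i).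
Proof.
by apply: (big_morph (mul_alg A u)) => [v w|]; rewrite ?mul_algDr ?mul_alg0r.
Qed.

Lemma mul_alg_suml I (r : seq I) (P : pred I) (f : I -> 'rV_n) u :
  mul_alg A (\sum_(i <- r | P i) f i) u = \sum_(i <- r | P i) mul_alg A (f i) u.
Proof.
by apply: (big_morph (mul_alg A ^~ u)) => [v w|]; rewrite ?mul_algDl ?mul_alg0l.
Qed.

Lemma mul_algE u v : mul_alg A u v = \sum_i \sum_j (u 0 i * v 0 j) *: mul_basis A i j.
Proof.
apply: eq_bigr => i _; apply: eq_bigr => j _.
by rewrite mxE big_ord1 mxE.
Qed.

Lemma mul_alg_delta i j : mul_alg A (delta_mx 0 i) (delta_mx 0 j) = mul_basis A i j.
Proof.
rewrite mul_algE (bigD1 i) //= [X in _ + X]big1 ?addr0 => [|k ki].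
  rewrite (bigD1 j) //= big1 ?addr0 => [|k kj]; first by rewrite !mxE !eqxx mulr1 scale1r.
  by rewrite !mxE !eqxx (negPf kj) mulr0 scale0r.
by rewrite big1 // => j' _; rewrite !mxE (negPf ki) mul0r scale0r.
Qed.

Definition alg_ring (_ : is_com_alg A) (_ : one_alg A != 0) : Type := 'rV[F]_n.

Variables (A_com : is_com_alg A) (A_nz : one_alg A != 0).

HB.instance Definition _ := GRing.Lmodule.copy (alg_ring A_com A_nz) 'rV[F]_n.

Fact alg_ring_mulA : associative (mul_alg A).
Proof. by case: A_com => mA _ _ u v w; rewrite mA. Qed.
Fact alg_ring_mulC : commutative (mul_alg A).
Proof. by case: A_com. Qed.
Fact alg_ring_mul1 : left_id (one_alg A) (mul_alg A).
Proof. by case: A_com. Qed.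
Fact alg_ring_mulDl : left_distributive (mul_alg A) +%R.
Proof. by move=> u v w; exact: mul_algDl. Qed.

HB.instance Definition _ := GRing.Zmodule_isComNzRing.Build (alg_ring A_com A_nz)
  alg_ring_mulA alg_ring_mulC alg_ring_mul1 alg_ring_mulDl A_nz.

Fact alg_ring_scaleAl (a : F) (u v : alg_ring A_com A_nz) : a *: (u * v) = (a *: u) * v.
Proof. by rewrite -[RHS]/(mul_alg A (a *: (u : 'rV_n)) v) mul_algZl. Qed.

HB.instance Definition _ := GRing.Lmodule_isLalgebra.Build F (alg_ring A_com A_nz)
  alg_ring_scaleAl.
HB.instance Definition _ := GRing.Lalgebra_isComAlgebra.Build F (alg_ring A_com A_nz).

End FinAlg.

Lemma one_alg_neq0 (F : fieldType) n (A : fin_alg F n) :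
  (0 < n)%N -> is_com_alg A -> one_alg A != 0.
Proof.
case: n A => // n A _ [_ _ mul1]; apply/eqP => one0.
have := mul1 (delta_mx 0 0); rewrite one0 mul_alg0l => /rowP/(_ 0)/eqP.
by rewrite !mxE eqxx eq_sym oner_eq0.
Qed.

Section Coordinates.
Variable F : fieldType.

Definition action_mx m n1 n2 (rho : 'I_m -> 'M[F]_(n1, n2)) (g : 'cV[F]_n2) : 'M_(m, n1) :=
  \matrix_(i, b) (rho i *m g) b 0.

Lemma row_action_mx m n1 n2 (rho : 'I_m -> 'M[F]_(n1, n2)) g i :
  row i (action_mx rho g) = (rho i *m g)^T.
Proof. by apply/rowP => b; rewrite !mxE. Qed.

Lemma linear_ext_mul m n1 n2 (rho : 'I_m -> 'M[F]_(n1, n2)) u g :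
  linear_ext rho u *m g = (u *m action_mx rho g)^T.
Proof.
rewrite /linear_ext mulmx_suml [u in RHS]row_sum_delta mulmx_suml linear_sum.
apply: eq_bigr => i _; rewrite -!scalemxAl linearZ -rowE row_action_mx.
by rewrite /= trmxK.
Qed.

Definition is_point n (A : fin_alg F n) (g : 'cV[F]_n) : Prop :=
  one_alg A *m g = 1 /\ forall u v, mul_alg A u v *m g = (u *m g) *m (v *m g).

Lemma mul2_point m n (A : fin_alg F m) (B : fin_alg F n) X Y g : is_point B g ->
  mul2 A B X Y *m g = (mul_alg A (X *m g)^T (Y *m g)^T)^T.
Proof.
case=> _ gM; rewrite mul_algE /mul2 linear_sum mulmx_suml; apply: eq_bigr => i _.
rewrite exchange_big mulmx_suml linear_sum /=; apply: eq_bigr => k _.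
transitivity (\sum_j \sum_l (X i j * Y k l * (g j 0 * g l 0)) *: (mul_basis A i k)^T).
  rewrite mulmx_suml; apply: eq_bigr => j _.
  rewrite mulmx_suml; apply: eq_bigr => l _.
  rewrite -scalemxAl -mulmxA -(mul_alg_delta B) gM -!rowE.
  rewrite [row j g *m _]mx11_scalar mul_mx_scalar scalerA.
  by rewrite !mxE big_ord1 !mxE.
under eq_bigr => j _ do rewrite -scaler_suml.
rewrite -scaler_suml linearZ; congr (_ *: _).
rewrite !mxE big_distrlr; apply: eq_bigr => j _; apply: eq_bigr => l _ /=.
by rewrite mulrACA.
Qed.

Lemma one2_point m n (A : fin_alg F m) (B : fin_alg F n) g : is_point B g ->
  one2 A B *m g = (one_alg A)^T.
Proof. by case=> g1 _; rewrite /one2 -mulmxA g1 mulmx1. Qed.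

Lemma mul_tensor_mul n (A : fin_alg F n) (X Y : 'M[F]_n) :
  mul_tensor A (X *m Y) = \sum_i \sum_j X i j *: mul_alg A (delta_mx 0 i) (row j Y).
Proof.
rewrite {1}(matrix_sum_delta X) mulmx_suml linear_sum; apply: eq_bigr => i _.
rewrite mulmx_suml linear_sum; apply: eq_bigr => j _.
rewrite -scalemxAl linearZ /= /mul_alg rowE mulmxA trmx_delta mul_delta_mx.
by [].
Qed.

Lemma mul_tensor_hom m n (A : fin_alg F m) (B : fin_alg F n) f X : is_alg_hom A B f ->
  mul_tensor A X *m f = mul_tensor B (f^T *m X *m f).
Proof.
case=> _ fM; rewrite [X]matrix_sum_delta.
rewrite mulmx_sumr mulmx_suml !linear_sum /= mulmx_suml; apply: eq_bigr => i _.
rewrite mulmx_sumr mulmx_suml !linear_sum /= mulmx_suml; apply: eq_bigr => j _.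
rewrite -scalemxAr -scalemxAl !linearZ /= -scalemxAl; congr (_ *: _).
rewrite -(mul_delta_mx (0 : 'I_1)) -trmx_delta -[mul_tensor A _]/(mul_alg A _ _) fM.
by rewrite /mul_alg trmx_mul !mulmxA.
Qed.

Lemma torsor_map_point n (G : fin_hopf F n) (T : fin_space F n) X g : is_point G g ->
  torsor_map G X *m g = (mul_tensor T (X *m action_mx (@coact_basis F n T) g))^T.
Proof.
move=> g_pt; rewrite mul_tensor_mul.
rewrite /torsor_map mulmx_suml linear_sum; apply: eq_bigr => i _.
rewrite mulmx_suml linear_sum; apply: eq_bigr => j _.
rewrite -scalemxAl mul2_point // linearZ row_action_mx; congr (_ *: (mul_alg _ _ _)^T).
by case: g_pt => g1 _; rewrite -mulmxA g1 mulmx1 trmxK.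
Qed.

(* Convolution of linear forms, the multiplication of the dual algebra. *)
Definition convol n (G : fin_hopf F n) (g h : 'cV[F]_n) : 'cV[F]_n :=
  (mul_alg (cartier_dual G) g^T h^T)^T.

Lemma convolE n (G : fin_hopf F n) g h r :
  convol G g h r 0 = \sum_t \sum_s g t 0 * h s 0 * comul_basis G r t s.
Proof.
rewrite /convol mul_algE mxE summxE; apply: eq_bigr => t _.
by rewrite summxE; apply: eq_bigr => s _; rewrite !mxE.
Qed.

Lemma action_mx_convol n (G : fin_hopf F n) d (rho : 'I_d -> 'M[F]_(d, n)) g h :
  is_comodule G rho ->
  action_mx rho g *m action_mx rho h = action_mx rho (convol G h g).
Proof.
case=> rhoM _; apply/matrixP => i b; rewrite !mxE.
transitivity (\sum_t \sum_s h t 0 * g s 0 * \sum_a rho i a s * rho a b t).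
  under eq_bigr => a _ do rewrite !mxE mulrC big_distrlr /=.
  rewrite exchange_big; apply: eq_bigr => t _ /=.
  rewrite exchange_big; apply: eq_bigr => s _ /=.
  by rewrite mulr_sumr; apply: eq_bigr => a _; ring.
under eq_bigr => t _ do under eq_bigr => s _ do rewrite rhoM mulr_sumr.
under eq_bigr => t _ do rewrite exchange_big.
rewrite exchange_big; apply: eq_bigr => r _ /=; rewrite convolE mulr_sumr.
apply: eq_bigr => t _; rewrite mulr_sumr; apply: eq_bigr => s _.
by ring.
Qed.

Lemma action_mx_counit n (G : fin_hopf F n) d (rho : 'I_d -> 'M[F]_(d, n)) :
  is_comodule G rho -> action_mx rho (counit G) = 1%:M.
Proof. by case=> _ rho1; apply/matrixP => i b; rewrite mxE rho1 !mxE andbT eq_sym. Qed.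

End Coordinates.

Section LinearBijective.
Variables (F : fieldType) (a b c d : nat) (f : {linear 'M[F]_(a, b) -> 'M[F]_(c, d)}).

Lemma linear_inj_row_free : injective f -> row_free (lin_mx f).
Proof.
move=> inj_f; apply: inj_row_free => v v0.
have : f (vec_mx v) = f 0.
  by apply: (can_inj mxvecK); rewrite -mul_vec_lin vec_mxK v0 !linear0.
by move/inj_f => /(congr1 mxvec); rewrite vec_mxK linear0.
Qed.

Lemma linear_bij_dim : bijective f -> (a * b = c * d)%N.
Proof.
move=> bij_f; apply/eqP; rewrite eqn_leq; apply/andP; split.
  by have /eqP <- := linear_inj_row_free (bij_inj bij_f); rewrite rank_leq_col.
have /eqP <- : row_full (lin_mx f); last by rewrite rank_leq_row.
rewrite -sub1mx; apply/row_subP => i; apply/submxP.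
case: bij_f => g _ gK; exists (mxvec (g (vec_mx (row i 1%:M)))).
by rewrite mul_vec_lin gK vec_mxK.
Qed.

Lemma linear_inj_bij : injective f -> (a * b = c * d)%N -> bijective f.
Proof.
move=> inj_f dim_eq; have rfree := linear_inj_row_free inj_f.
have rfull : row_full (lin_mx f) by rewrite /row_full (eqP rfree) dim_eq.
have f_surj Y : exists X, f X == Y.
  have /submxP[v defY] := submx_full (mxvec Y) rfull.
  by exists (vec_mx v); rewrite -(can_eq mxvecK) -mul_vec_lin vec_mxK defY.
exists (fun Y => xchoose (f_surj Y)) => [X|Y]; last exact: eqP (xchooseP (f_surj Y)).
by apply: inj_f; exact: eqP (xchooseP (f_surj (f X))).
Qed.

End LinearBijective.

Lemma mulmxr_bij (F : fieldType) m n (f : 'M[F]_(m, n)) :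
  bijective (fun u : 'rV[F]_m => u *m f) ->
  exists2 g : 'M[F]_(n, m), f *m g = 1%:M & g *m f = 1%:M.
Proof.
case=> h fK hK; pose g := \matrix_i h (delta_mx 0 i).
have gf : g *m f = 1%:M.
  by apply/row_matrixP => i; rewrite row_mul rowK hK row1.
exists g => //; apply/row_matrixP => i; apply: (can_inj fK).
by rewrite -row_mul -mulmxA gf mulmx1 row1 -rowE.
Qed.

Lemma mx_sub1_exp_pchar (F : fieldType) d (A : 'M[F]_d.+1) p m :
  p \in [pchar F] -> (A - 1) ^+ (p ^ m)%N = A ^+ (p ^ m)%N - 1.
Proof.
move=> pchar_F; have pchar_P : p \in [pchar {poly F}].
  by rewrite (rmorph_pchar (polyC : {rmorphism F -> {poly F}}) pchar_F).
have X1q : ('X - 1 : {poly F}) ^+ (p ^ m)%N = 'X^(p ^ m)%N - 1.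
  elim: m => [|m IHm]; first by rewrite expn0 !expr1.
  by rewrite expnSr !exprM IHm -!(pFrobenius_autE pchar_P) rmorphB rmorph1.
have := congr1 (horner_mx A) X1q.
by rewrite rmorphXn !rmorphB rmorph1 rmorphXn /= horner_mx_X.
Qed.

Section TorsorMap.
Variables (F : fieldType) (n : nat) (G : fin_hopf F n) (T : fin_space F n).

Lemma torsor_map_is_linear : linear (@torsor_map F n G T).
Proof.
move=> a X Y; rewrite /torsor_map scaler_sumr -big_split; apply: eq_bigr => i _.
rewrite scaler_sumr -big_split; apply: eq_bigr => j _ /=.
by rewrite !mxE scalerDl scalerA.
Qed.

HB.instance Definition _ := GRing.isLinear.Build F 'M[F]_(space_dim T)
  'M[F]_(space_dim T, n) _ (@torsor_map F n G T) torsor_map_is_linear.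

Lemma torsor_dim : is_torsor G T -> space_dim T = n.
Proof.
case=> T_gt0 _ _ _ /linear_bij_dim/eqP.
by rewrite eqn_pmul2l // => /eqP.
Qed.

End TorsorMap.

Section ActionLinear.
Variables (F : fieldType) (n : nat).

Lemma action_mx_is_linear m n1 (rho : 'I_m -> 'M[F]_(n1, n)) : linear (action_mx rho).
Proof.
move=> a g h; apply/row_matrixP => i.
by rewrite linearP /= !row_action_mx mulmxDr -scalemxAr linearP.
Qed.

HB.instance Definition _ m n1 (rho : 'I_m -> 'M[F]_(n1, n)) :=
  GRing.isLinear.Build F 'cV[F]_n 'M[F]_(m, n1) _ (action_mx rho) (action_mx_is_linear rho).

Lemma convol_is_linear (G : fin_hopf F n) g : linear (convol G g).
Proof. by move=> a h h'; rewrite /convol !linearP /= mul_algDr mul_algZr linearP. Qed.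

HB.instance Definition _ (G : fin_hopf F n) g :=
  GRing.isLinear.Build F 'cV[F]_n 'cV[F]_n _ (convol G g) (convol_is_linear G g).

Lemma convol_suml (G : fin_hopf F n) I (r : seq I) (P : pred I) a (f : I -> 'cV_n) h :
  convol G (\sum_(i <- r | P i) a i *: f i) h = \sum_(i <- r | P i) a i *: convol G (f i) h.
Proof.
rewrite /convol [(\sum_(i <- r | P i) _)^T]linear_sum mul_alg_suml linear_sum.
by apply: eq_bigr => i _; rewrite linearZ /= mul_algZl linearZ.
Qed.

End ActionLinear.

Lemma is_alg_hom_action (F : fieldType) n (G : fin_hopf F n) d e (A : fin_alg F d)
  (T : fin_alg F e) (rho : 'I_d -> 'M[F]_(e, n)) g :
  is_alg_hom2 A T G rho -> is_point G g -> is_alg_hom A T (action_mx rho g).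
Proof.
case=> rho1 rhoM g_pt; split=> [|u v]; apply: trmx_inj.
  by rewrite -linear_ext_mul rho1 one2_point.
by rewrite -!linear_ext_mul rhoM mul2_point // !linear_ext_mul !trmxK.
Qed.

Section PointBasis.
Variables (F : fieldType) (n : nat) (G : fin_hopf F n) (M : 'M[F]_n).
Hypotheses (M_unit : M \in unitmx) (M_pt : forall c, is_point G (col c M)).

Lemma eq_mx_points d (X Y : 'M[F]_(d, n)) :
  (forall c, X *m col c M = Y *m col c M) -> X = Y.
Proof.
move=> XY; apply: (can_inj (mulmxK M_unit)); apply/matrixP => i c.
have := XY c; rewrite !colE !mulmxA -!colE => /matrixP/(_ i 0).
by rewrite !mxE.
Qed.

Lemma is_alg_hom2_points d e (A : fin_alg F d) (T : fin_alg F e) (rho : 'I_d -> 'M[F]_(e, n)) :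
  is_alg_hom2 A T G rho <-> forall c, is_alg_hom A T (action_mx rho (col c M)).
Proof.
split=> [rho_hom c|rho_hom]; first exact: is_alg_hom_action rho_hom (M_pt c).
split=> [|u v]; apply: eq_mx_points => c; have [f1 fM] := rho_hom c.
  by rewrite linear_ext_mul f1 one2_point.
by rewrite linear_ext_mul fM mul2_point // !linear_ext_mul !trmxK.
Qed.

Definition coaction_of d (s : 'I_n -> 'M[F]_d) (i : 'I_d) : 'M[F]_(d, n) :=
  (\matrix_(b, c) s c i b) *m invmx M.

Lemma action_coaction_of d (s : 'I_n -> 'M[F]_d) c :
  action_mx (coaction_of s) (col c M) = s c.
Proof.
apply/matrixP => i b.
rewrite mxE /coaction_of -mulmxA colE mulKmx // -colE.
by rewrite !mxE.
Qed.

Lemma points_span (g : 'cV[F]_n) : g = \sum_c (invmx M *m g) c 0 *: col c M.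
Proof.
rewrite -[LHS](mulKVmx M_unit); apply/colP => i; rewrite mxE summxE.
by apply: eq_bigr => c _; rewrite !mxE mulrC.
Qed.

Lemma is_comodule_points d (rho : 'I_d -> 'M[F]_(d, n)) :
  (forall c c', action_mx rho (col c M) *m action_mx rho (col c' M)
                = action_mx rho (convol G (col c' M) (col c M))) ->
  action_mx rho (counit G) = 1%:M -> is_comodule G rho.
Proof.
move=> rhoM rho1.
have {}rhoM g h : action_mx rho g *m action_mx rho h = action_mx rho (convol G h g).
  rewrite (points_span h) convol_suml !(linear_sum (action_mx rho)) mulmx_sumr.
  apply: eq_bigr => c' _; rewrite !linearZ /=; congr (_ *: _).
  rewrite (points_span g) (linear_sum (convol G _)) !(linear_sum (action_mx rho)) mulmx_suml.
  apply: eq_bigr => c _; rewrite [in RHS]linearZ !linearZ /=.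
  by rewrite -scalemxAl rhoM.
split=> [i b t s|i]; last first.
  apply/colP => b; have /matrixP/(_ i b) := rho1; rewrite !mxE => ->.
  by rewrite andbT eq_sym.
have /matrixP/(_ i b) := rhoM (delta_mx s 0) (delta_mx t 0).
have action_delta j a u : action_mx rho (delta_mx u 0) j a = rho j a u.
  by rewrite mxE -colE mxE.
rewrite mxE; under eq_bigr => a _ do rewrite !action_delta; move=> ->.
rewrite mxE mxE; apply: eq_bigr => r _; congr (_ * _).
rewrite convolE (bigD1 t) //= [X in _ + X]big1 ?addr0 => [|t' tt'].
  rewrite (bigD1 s) //= big1 ?addr0 => [|s' ss']; first by rewrite !mxE !eqxx !mul1r.
  by rewrite !mxE (negPf ss') mulr0 mul0r.
by apply: big1 => s' _; rewrite !mxE (negPf tt') !mul0r.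
Qed.

Lemma is_torsor_points (T : fin_space F n) :
  let s c := action_mx (@coact_basis F n T) (col c M) in
  (0 < n)%N -> space_dim T = n -> is_com_alg T -> (forall c, is_alg_hom T T (s c)) ->
  (forall c c', s c *m s c' =
     action_mx (@coact_basis F n T) (convol G (col c' M) (col c M))) ->
  action_mx (@coact_basis F n T) (counit G) = 1%:M ->
  (forall X, (forall c, mul_tensor T (X *m s c) = 0) -> X = 0) ->
  is_torsor G T.
Proof.
move=> s n_gt0 dn T_com s_hom sM s1 s_free; split=> //; first by rewrite dn.
- exact: is_comodule_points.
- exact/is_alg_hom2_points.
suff inj_tm : injective (@torsor_map F n G T).
  pose f : {linear 'M[F]_(space_dim T) -> 'M[F]_(space_dim T, n)} := @torsor_map F n G T.
  by apply: (linear_inj_bij (f := f)) => //; rewrite dn.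
apply: raddf_inj => X X0; apply: s_free => c.
have := torsor_map_point (T := T) X (M_pt c).
by rewrite X0 mul0mx => /esym/(congr1 trmx); rewrite trmxK linear0.
Qed.

End PointBasis.

Section BaseChangeTheory.
Variables (F K : fieldType) (f : {rmorphism F -> K}).

Lemma map_mul_tensor n (A : fin_alg F n) X :
  map_mx f (mul_tensor A X) = mul_tensor (alg_bc f A) (map_mx f X).
Proof.
rewrite /mul_tensor raddf_sum; apply: eq_bigr => i _.
by rewrite raddf_sum; apply: eq_bigr => j _; rewrite /= map_mxZ mxE.
Qed.

Lemma map_mul_alg n (A : fin_alg F n) u v :
  map_mx f (mul_alg A u v) = mul_alg (alg_bc f A) (map_mx f u) (map_mx f v).
Proof. by rewrite map_mul_tensor map_mxM -map_trmx. Qed.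

Lemma map_linear_ext m n1 n2 (rho : 'I_m -> 'M[F]_(n1, n2)) u :
  map_mx f (linear_ext rho u) = linear_ext (fun i => map_mx f (rho i)) (map_mx f u).
Proof.
by rewrite /linear_ext raddf_sum; apply: eq_bigr => i _; rewrite /= map_mxZ mxE.
Qed.

Lemma map_mul2 m n (A : fin_alg F m) (B : fin_alg F n) X Y :
  map_mx f (mul2 A B X Y) = mul2 (alg_bc f A) (alg_bc f B) (map_mx f X) (map_mx f Y).
Proof.
rewrite /mul2 raddf_sum; apply: eq_bigr => i _.
rewrite raddf_sum; apply: eq_bigr => j _.
rewrite raddf_sum; apply: eq_bigr => k _.
rewrite raddf_sum; apply: eq_bigr => l _.
by rewrite /= map_mxZ map_mxM -map_trmx rmorphM !mxE.
Qed.

Lemma map_one2 m n (A : fin_alg F m) (B : fin_alg F n) :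
  map_mx f (one2 A B) = one2 (alg_bc f A) (alg_bc f B).
Proof. by rewrite /one2 map_mxM -map_trmx. Qed.

Lemma map_torsor_map n (G : fin_hopf F n) (T : fin_space F n) X :
  map_mx f (torsor_map G X) = @torsor_map _ _ (hopf_bc f G) (space_bc f T) (map_mx f X).
Proof.
rewrite /torsor_map raddf_sum; apply: eq_bigr => i _.
rewrite raddf_sum; apply: eq_bigr => j _.
by rewrite /= map_mxZ map_mul2 map_mxM -map_trmx map_delta_mx mxE.
Qed.

Lemma map_action_mx m n1 n2 (rho : 'I_m -> 'M[F]_(n1, n2)) g :
  map_mx f (action_mx rho g) = action_mx (fun i => map_mx f (rho i)) (map_mx f g).
Proof. by apply/row_matrixP => i; rewrite -map_row !row_action_mx -map_trmx map_mxM. Qed.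

Lemma is_point_bc n (A : fin_alg F n) g : is_point A g -> is_point (alg_bc f A) (map_mx f g).
Proof.
case=> g1 gM; split; first by rewrite -map_mxM g1 map_scalar_mx rmorph1.
suff gMb i j : mul_basis (alg_bc f A) i j *m map_mx f g
    = (delta_mx 0 i *m map_mx f g) *m (delta_mx 0 j *m map_mx f g).
  move=> u v; rewrite mul_algE mulmx_suml [u in RHS]row_sum_delta [v in RHS]row_sum_delta.
  rewrite !mulmx_suml; apply: eq_bigr => i _; rewrite mulmx_suml mulmx_sumr.
  apply: eq_bigr => j _; rewrite -!scalemxAl gMb -scalemxAr scalerA; congr (_ *: _).
by rewrite -!(map_delta_mx f) -!map_mxM -gM mul_alg_delta.
Qed.

Lemma map_convol n (G : fin_hopf F n) g h :
  map_mx f (convol G g h) = convol (hopf_bc f G) (map_mx f g) (map_mx f h).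
Proof.
apply/colP => r; rewrite mxE !convolE rmorph_sum; apply: eq_bigr => t _.
by rewrite rmorph_sum; apply: eq_bigr => s _; rewrite !rmorphM !mxE.
Qed.

Lemma is_torsor_reflect n (G : fin_hopf F n) (T : fin_space F n) :
  is_torsor (hopf_bc f G) (space_bc f T) -> is_torsor G T.
Proof.
move=> torT; have dn := torsor_dim torT.
case: torT => /= T_gt0 [mA mC m1] [rhoM rho1] [rho_one rho_mul] tm_bij.
split=> //.
- split=> [u v w|u v|u]; apply: (map_mx_inj (f := f)); rewrite !map_mul_alg.
  + exact: mA.
  + exact: mC.
  + exact: m1.
- split=> [i b t s|i]; last first.
    apply: (map_mx_inj (f := f)); rewrite map_mxM map_delta_mx; exact: rho1.
  apply: (fmorph_inj f); rewrite !rmorph_sum; have := rhoM i b t s.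
  by under eq_bigr do rewrite !mxE -rmorphM; move=> ->;
    apply: eq_bigr => r _; rewrite !mxE rmorphM.
- split=> [|u v]; apply: (map_mx_inj (f := f)).
    by rewrite map_linear_ext map_one2; exact: rho_one.
  by rewrite map_linear_ext map_mul_alg map_mul2 !map_linear_ext; exact: rho_mul.
pose tm : {linear 'M[F]_(space_dim T) -> 'M[F]_(space_dim T, n)} := @torsor_map F n G T.
apply: (linear_inj_bij (f := tm)); last by rewrite [space_dim T]dn.
move=> X Y XY; apply: (map_mx_inj (f := f)); apply: (bij_inj tm_bij).
by rewrite -!map_torsor_map; congr map_mx.
Qed.

End BaseChangeTheory.

Lemma hopf_bc_comp (F L K : fieldType) (i : {rmorphism F -> L}) (j : {rmorphism L -> K})
  (h : {rmorphism F -> K}) n (G : fin_hopf F n) :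
  j \o i =1 h -> hopf_bc j (hopf_bc i G) = hopf_bc h G.
Proof.
move=> ji; have map_ji m l (X : 'M[F]_(m, l)) : map_mx j (map_mx i X) = map_mx h X.
  by rewrite -map_mx_comp; exact: eq_map_mx.
rewrite /hopf_bc /alg_bc /=; congr (FinHopf (FinAlg _ _) _ _); do ?exact: map_ji.
  by apply/funext => a; apply/funext => b; exact: map_ji.
by apply/funext => a; exact: map_ji.
Qed.

Lemma hopf_bc_const (F K : fieldType) (f : {rmorphism F -> K}) m :
  hopf_bc f (const_Zm F m) = const_Zm K m.
Proof.
rewrite /hopf_bc /alg_bc /const_Zm /=; congr (FinHopf (FinAlg _ _) _ _).
- apply/funext => a; apply/funext => b; rewrite map_mxZ map_delta_mx.
  by rewrite rmorph_nat.
- by rewrite map_const_mx rmorph1.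
- by apply/funext => c; apply/matrixP => a b; rewrite !mxE rmorph_nat.
- by apply/matrixP => a b; rewrite !mxE rmorph_nat.
Qed.

Section Transport.
Variables (F : fieldType) (n : nat) (G : fin_hopf F n) (M : 'M[F]_n).
Hypotheses (M_unit : M \in unitmx) (M_pt : forall c, is_point G (col c M)).
Variables S T : fin_space F n.

Lemma action_mx_morph (f : 'M[F]_(space_dim S, space_dim T)) g :
  (forall i, f^T *m @coact_basis F n S i = linear_ext (@coact_basis F n T) (row i f)) ->
  action_mx (@coact_basis F n S) g *m f = f *m action_mx (@coact_basis F n T) g.
Proof.
move=> fP; apply/row_matrixP => i; rewrite !row_mul row_action_mx.
by apply: trmx_inj; rewrite trmx_mul trmxK -linear_ext_mul -fP mulmxA.
Qed.

Lemma is_torsor_iso : space_iso S T -> is_torsor G T -> is_torsor G S.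
Proof.
case=> f [/mulmxr_bij[g fg gf] [f1 fM] f_act] torT.
have dT := torsor_dim torT; case: (torT) => T_gt0 [mA mC m1] T_comod T_hom T_bij.
have f_inj (u v : 'rV_(space_dim S)) : u *m f = v *m f -> u = v.
  by move=> uv; rewrite -[u]mulmx1 -[v]mulmx1 -fg !mulmxA uv.
have dS : space_dim S = n.
  apply: (etrans _ dT).
  have rankS : \rank f = space_dim S.
    apply/eqP; rewrite eqn_leq rank_leq_row -{1}(mxrank1 F (space_dim S)) -fg.
    exact: mxrankM_maxl.
  have rankT : \rank f = space_dim T.
    apply/eqP; rewrite eqn_leq rank_leq_col -{1}(mxrank1 F (space_dim T)) -gf.
    exact: mxrankM_maxr.
  exact: etrans (esym rankS) rankT.
have act_f h := action_mx_morph h f_act.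
have act_S h : action_mx (@coact_basis F n S) h
    = f *m action_mx (@coact_basis F n T) h *m g.
  by rewrite -act_f -mulmxA fg mulmx1.
apply: (is_torsor_points M_unit M_pt) => //.
- by rewrite dT in T_gt0.
- split=> [u v w|u v|u]; apply: f_inj; rewrite !fM ?f1.
  + exact: mA.
  + exact: mC.
  + exact: m1.
- move=> c; have [T1 TM] := (is_alg_hom2_points M_unit M_pt _ _ _).1 T_hom c.
  split=> [|u v]; apply: f_inj; rewrite -mulmxA act_f mulmxA.
    by rewrite f1.
  by rewrite fM TM fM -!mulmxA !act_f.
- move=> c c'; rewrite !act_S -(action_mx_convol _ _ T_comod) -!mulmxA.
  by rewrite (mulmxA g) gf mul1mx.
- by rewrite act_S (action_mx_counit T_comod) mulmx1 fg.
move=> X X0; suff fXf : f^T *m X *m f = 0.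
  have -> : X = g^T *m (f^T *m X *m f) *m g.
    by rewrite !mulmxA -trmx_mul fg trmx1 mul1mx -mulmxA fg mulmx1.
  by rewrite fXf mulmx0 mul0mx.
apply: (bij_inj T_bij); apply: (eq_mx_points M_unit) => c.
rewrite (_ : torsor_map G 0 = 0); last exact: (linear0 (@torsor_map F n G T)).
rewrite mul0mx torsor_map_point //; apply: trmx_inj; rewrite trmxK linear0.
rewrite -mulmxA -act_f mulmxA -(mulmxA f^T) -(@mul_tensor_hom _ _ _ S T f) //.
by rewrite X0 mul0mx.
Qed.

End Transport.

(** * Torsors under Z/q *)

Section ConstantGroup.
Variables (F : fieldType) (q : nat).

Lemma prod_algE (u v : 'rV[F]_q) : mul_alg (prod_alg F q) u v = \row_c (u 0 c * v 0 c).
Proof.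
apply/rowP => c; rewrite mul_algE summxE mxE (bigD1 c) //= [X in _ + X]big1 ?addr0.
  rewrite summxE (bigD1 c) //= big1 ?addr0 => [|b bc].
    by rewrite !mxE !eqxx !mulr1.
  by rewrite eq_sym (negPf bc) scale0r scaler0 mxE.
move=> a ac; rewrite summxE big1 // => b _.
by rewrite !mxE (eq_sym c a) (negPf ac) !mulr0.
Qed.

Lemma prod_alg_point (c : 'I_q) : is_point (prod_alg F q) (delta_mx c 0).
Proof.
split=> [|u v]; apply/matrixP => i j; rewrite !ord1 {i j} -!colE !mxE.
  by [].
by rewrite big_ord1 prod_algE !mxE.
Qed.

Lemma is_alg_hom_prodP m (A : fin_alg F m) (f : 'M[F]_(m, q)) :
  is_alg_hom A (prod_alg F q) f <-> forall c, is_point A (col c f).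
Proof.
split=> [[f1 fM] c|f_pt].
  split=> [|u v]; rewrite colE mulmxA ?f1 ?fM.
    by have [-> _] := prod_alg_point c.
  by have [_ ->] := prod_alg_point c; rewrite -!mulmxA.
split=> [|u v]; apply/rowP => c; have [f1 fM] := f_pt c.
  have := congr1 (fun X : 'M_1 => X 0 0) f1.
  by rewrite colE mulmxA -colE !mxE.
rewrite prod_algE [RHS]mxE.
have : (mul_alg A u v *m col c f) 0 0 = (u *m col c f) 0 0 * (v *m col c f) 0 0.
  by rewrite fM mxE big_ord1.
rewrite !colE !mulmxA -!colE.
by rewrite ![col _ _ 0 0]mxE.
Qed.

Definition ord_add_mod (a b : 'I_q) : 'I_q :=
  Ordinal (ltn_pmod (a + b) (leq_ltn_trans (leq0n a) (ltn_ord a))).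

Lemma convol_const (a b : 'I_q) :
  convol (const_Zm F q) (delta_mx a 0) (delta_mx b 0) = delta_mx (ord_add_mod a b) 0.
Proof.
apply/colP => r; rewrite convolE (bigD1 a) //= [X in _ + X]big1 ?addr0.
  rewrite (bigD1 b) //= big1 ?addr0 => [|b' bb'].
    by rewrite !mxE !eqxx !mul1r andbT eq_sym.
  by rewrite !mxE (negPf bb') mulr0 mul0r.
by move=> a' aa'; rewrite big1 // => b' _; rewrite !mxE (negPf aa') !mul0r.
Qed.

Lemma counit_const (a : 'I_q) : a = 0%N :> nat -> counit (const_Zm F q) = delta_mx a 0.
Proof. by move=> a0; apply/colP => b; rewrite !mxE andbT -val_eqE /= a0. Qed.

Lemma const_point (c : 'I_q) : is_point (const_Zm F q) (col c 1%:M).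
Proof. by rewrite colE mul1mx; exact: prod_alg_point. Qed.

End ConstantGroup.

Section Descent.
Variables (L K : fieldType) (j : {rmorphism L -> K}) (q r : nat) (T : fin_space K q).
Variables (Q : 'M[K]_(r, space_dim T)) (Q' : 'M[K]_(space_dim T, r)).
Hypotheses (QQ' : Q *m Q' = 1%:M) (Q'Q : Q' *m Q = 1%:M).
Hypothesis T_torsor : is_torsor (const_Zm K q) T.
Hypothesis Q_one : exists x, map_mx j x *m Q = one_alg T.
Hypothesis Q_mul : forall a b, exists x, map_mx j x *m Q = mul_alg T (row a Q) (row b Q).
Hypothesis Q_act : forall c, exists X,
  map_mx j X *m Q = Q *m action_mx (@coact_basis K q T) (delta_mx c 0).

Lemma descend_const_torsor :
  exists S : fin_space L q, is_torsor (const_Zm L q) S /\ space_iso (space_bc j S) T.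
Proof.
have [one1 one1P] := Q_one.
have /choice[mul mulP] : forall ab : 'I_r * 'I_r, exists x,
    map_mx j x *m Q = mul_alg T (row ab.1 Q) (row ab.2 Q) by move=> [a b]; exact: Q_mul.
have /choice[act actP] := Q_act.
pose S := @FinSpace L q r (FinAlg (fun a b => mul (a, b)) one1)
  (fun i => \matrix_(b, c) act c i b).
have S_iso : space_iso (space_bc j S) T.
  exists Q; split.
  - by exists (mulmx^~ Q') => u; rewrite -mulmxA ?QQ' ?Q'Q mulmx1.
  - split; first exact: one1P.
    move=> u v; rewrite mul_algE [u in RHS]row_sum_delta [v in RHS]row_sum_delta.
    rewrite !mulmx_suml mul_alg_suml; apply: eq_bigr => a _.
    rewrite mulmx_suml mul_alg_sumr; apply: eq_bigr => b _.
    rewrite -!scalemxAl mul_algZl mul_algZr scalerA; congr (_ *: _).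
    by rewrite -!rowE; exact: mulP (a, b).
  move=> i; apply: (eq_mx_points (unitmx1 _ _)) => c.
  rewrite linear_ext_mul -mulmxA; apply: trmx_inj; rewrite trmxK trmx_mul trmxK.
  rewrite colE mul1mx -row_mul -actP row_mul; congr (_ *m _).
  by apply/rowP => b; rewrite -colE !mxE.
exists S; split=> //; apply: (is_torsor_reflect (f := j)).
rewrite hopf_bc_const.
by apply: is_torsor_iso S_iso T_torsor; [exact: unitmx1|exact: const_point].
Qed.

End Descent.

Section AlgHomMorphism.
Variables (F : fieldType) (n : nat) (A : fin_alg F n).
Variables (A_com : is_com_alg A) (A_nz : one_alg A != 0).
Local Notation R := (alg_ring A_com A_nz).

Definition alg_hom_fun (f : 'M[F]_n) (_ : is_alg_hom A A f) (u : R) : R :=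
  (u : 'rV[F]_n) *m f.

Variables (f : 'M[F]_n) (f_hom : is_alg_hom A A f).

Fact alg_hom_fun_zmod : zmod_morphism (alg_hom_fun f_hom).
Proof. by move=> u v; exact: mulmxBl. Qed.
Fact alg_hom_fun_monoid : monoid_morphism (alg_hom_fun f_hom).
Proof. by case: f_hom => f1 fM; split=> [|u v]; [exact: f1|exact: fM]. Qed.
Fact alg_hom_fun_scalable : scalable (alg_hom_fun f_hom).
Proof. by move=> a u; exact: esym (scalemxAl _ _ _). Qed.

HB.instance Definition _ := GRing.isZmodMorphism.Build R R (alg_hom_fun f_hom) alg_hom_fun_zmod.
HB.instance Definition _ := GRing.isMonoidMorphism.Build R R (alg_hom_fun f_hom) alg_hom_fun_monoid.
HB.instance Definition _ :=
  GRing.isScalable.Build F R R *:%R (alg_hom_fun f_hom) alg_hom_fun_scalable.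

End AlgHomMorphism.

Section CyclicTorsor.
Variables (F : fieldType) (q : nat) (T : fin_space F q).
Hypothesis T_torsor : is_torsor (const_Zm F q) T.

Let T_gt0 : (0 < space_dim T)%N. Proof. by case: T_torsor. Qed.
Let q_gt0 : (0 < q)%N. Proof. by rewrite -(torsor_dim T_torsor). Qed.
Let T_comod : is_comodule (const_Zm F q) (@coact_basis F q T).
Proof. by case: T_torsor. Qed.

Lemma torsor_com : is_com_alg T. Proof. by case: T_torsor. Qed.
Lemma torsor_nz : one_alg T != 0. Proof. exact: one_alg_neq0 torsor_com. Qed.

Definition torsor_act (c : 'I_q) := action_mx (@coact_basis F q T) (delta_mx c 0).

Lemma torsor_act_hom c : is_alg_hom T T (torsor_act c).
Proof.
have [_ _ _ T_hom _] := T_torsor.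
have := (is_alg_hom2_points (unitmx1 F q) (@const_point F q) _ _ _).1 T_hom c.
by rewrite colE mul1mx.
Qed.

Lemma torsor_act_add a b : torsor_act a *m torsor_act b = torsor_act (ord_add_mod b a).
Proof. by rewrite /torsor_act (action_mx_convol _ _ T_comod) convol_const. Qed.

Lemma torsor_act0 (a : 'I_q) : a = 0%N :> nat -> torsor_act a = 1%:M.
Proof.
by move=> a0; rewrite /torsor_act -(counit_const _ a0) (action_mx_counit T_comod).
Qed.

Definition ord_mod k : 'I_q := Ordinal (ltn_pmod k q_gt0).

Definition torsor_ring := alg_ring torsor_com torsor_nz.
HB.instance Definition _ := GRing.ComAlgebra.on torsor_ring.

Definition torsor_gen : torsor_ring -> torsor_ring :=
  @alg_hom_fun F _ T torsor_com torsor_nz _ (torsor_act_hom (ord_mod 1)).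
HB.instance Definition _ := GRing.LRMorphism.on torsor_gen.

Lemma iter_torsor_gen k (u : torsor_ring) :
  iter k torsor_gen u = (u : 'rV_(space_dim T)) *m torsor_act (ord_mod k).
Proof.
elim: k => [|k IHk]; first by rewrite torsor_act0 ?mulmx1 //= mod0n.
rewrite iterS IHk /torsor_gen /alg_hom_fun -mulmxA torsor_act_add.
by congr (_ *m torsor_act _); apply: val_inj; rewrite /= modnDm.
Qed.

Lemma torsor_ring1 : (1 : torsor_ring) = one_alg T. Proof. by []. Qed.

Let torsor_map_mul X c :
  torsor_map (const_Zm F q) X *m delta_mx c 0 = (mul_tensor T (X *m torsor_act c))^T.
Proof. by apply: torsor_map_point; exact: prod_alg_point. Qed.

Lemma torsor_gen_fixed (b : torsor_ring) : torsor_gen b = b -> exists a, b = a%:A.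
Proof.
move=> b_fix.
have b_act c : (b : 'rV_(space_dim T)) *m torsor_act c = b.
  have -> : c = ord_mod c by apply: val_inj; rewrite /= modn_small.
  by rewrite -iter_torsor_gen; elim: (c : nat) => //= k ->.
pose X := (one_alg T)^T *m (b : 'rV_(space_dim T)) - (b : 'rV_(space_dim T))^T *m one_alg T.
have X0 : X = 0.
  have [_ _ _ _ /bij_inj tm_inj] := T_torsor; apply: tm_inj.
  have -> : torsor_map (const_Zm F q) (0 : 'M_(space_dim T)) = 0.
    exact: (linear0 (@torsor_map F q (const_Zm F q) T)).
  apply: (eq_mx_points (unitmx1 F q)) => c; rewrite colE mul1mx mul0mx torsor_map_mul.
  apply: trmx_inj; rewrite trmxK linear0 /X mulmxBl linearB /= -!mulmxA b_act.
  have [-> _] := torsor_act_hom c.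
  have [_ mC _] := torsor_com.
  by apply/eqP; rewrite subr_eq0; apply/eqP; exact: mC.
have /rV0Pn[i ei] := torsor_nz.
exists ((b : 'rV_(space_dim T)) 0 i / one_alg T 0 i); apply/rowP => k.
have /matrixP/(_ i k) := X0; rewrite !mxE !big_ord1 !mxE => /eqP; rewrite subr_eq0 => /eqP be.
by rewrite torsor_ring1 mulrAC -be [one_alg T 0 i * _]mulrC mulfK.
Qed.

Lemma cyclic_trace_torsor_gen (u : torsor_ring) :
  cyclic_trace torsor_gen q u = (u : 'rV_(space_dim T)) *m \sum_c torsor_act c.
Proof.
rewrite mulmx_sumr; apply: eq_bigr => c _; rewrite iter_torsor_gen.
by congr (_ *m torsor_act _); apply: val_inj; rewrite /= modn_small.
Qed.

Lemma torsor_trace1 : exists theta : torsor_ring, cyclic_trace torsor_gen q theta = 1.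
Proof.
pose W := \sum_c torsor_act c.
have tr_scalar (u : torsor_ring) : exists a, cyclic_trace torsor_gen q u = a%:A.
  apply: torsor_gen_fixed; apply/eqP; rewrite -subr_eq0; apply/eqP.
  transitivity (iter q torsor_gen u - u).
    rewrite /cyclic_trace rmorph_sum -sumrB.
    rewrite -(big_mkord xpredT (fun j => torsor_gen (iter j torsor_gen u) - iter j torsor_gen u)).
    by rewrite (telescope_sumr (fun j => iter j torsor_gen u)).
  rewrite iter_torsor_gen torsor_act0 ?mulmx1 ?subrr //=.
  by rewrite modnn.
suff [j [a [a_neq0 tr_j]]] : exists j a, a != 0 /\
    cyclic_trace torsor_gen q (delta_mx 0 j : torsor_ring) = a%:A.
  exists (a^-1 *: (delta_mx 0 j : torsor_ring)); rewrite /cyclic_trace.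
  under eq_bigr => k _ do rewrite -[iter k _ _]/(iter_morph torsor_gen k _) iter_morph_scalable.
  by rewrite -scaler_sumr [X in _ *: X]tr_j scalerA mulVf ?scale1r.
apply: contrapT => no_j.
have W0 : W = 0.
  apply/row_matrixP => j; rewrite row0.
  have [a tr_j] := tr_scalar (delta_mx 0 j).
  rewrite cyclic_trace_torsor_gen -rowE in tr_j; rewrite [LHS]tr_j.
  have [->|an0] := eqVneq a 0; first exact: scale0r.
  by case: no_j; exists j, a; split=> //; rewrite cyclic_trace_torsor_gen -rowE.
have [_ _ _ _ [h _ hK]] := T_torsor.
pose Y : 'M_(space_dim T, q) := \matrix_(i, c) (one_alg T 0 i * (c == 0%N :> nat)%:R).
have /eqP[] := torsor_nz.
have <- : mul_tensor T (h Y *m W) = one_alg T.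
  rewrite mulmx_sumr linear_sum /= (bigD1 (Ordinal q_gt0)) //= big1 ?addr0 => [|c c0].
    apply: trmx_inj; rewrite -torsor_map_mul hK; apply/colP => i.
    by rewrite -colE !mxE mulr1.
  apply: trmx_inj; rewrite -torsor_map_mul hK linear0; apply/colP => i.
  rewrite -colE !mxE (_ : (c == 0%N :> nat) = false) ?mulr0 //.
  exact: negPf c0.
by rewrite W0 mulmx0 linear0.
Qed.

End CyclicTorsor.

Lemma algebraic_over_mpoly_var (F K : fieldType) (i : {rmorphism F -> K}) n (t : 'I_n -> K) l :
  algebraic_over_mpoly i t (t l).
Proof.
exists ('X - ('X_l)%:P).
  rewrite rmorphB /= map_polyX map_polyC /= mmapX mmap1U.
  exact: monic_neq0 (monicXsubC _).
by rewrite rmorphB /= map_polyX map_polyC /= mmapX mmap1U root_XsubC.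
Qed.

Lemma rmorph_image_subring (L K : fieldType) (j : {rmorphism L -> K}) :
  subring_pred (fun x => exists y, j y = x).
Proof.
split; first by exists 1; rewrite rmorph1.
- by move=> _ _ [x <-] [y <-]; exists (x - y); rewrite rmorphB.
- by move=> _ _ [x <-] [y <-]; exists (x * y); rewrite rmorphM.
Qed.

Lemma cyclic_torsor_defined (p n : nat) (k K : fieldType) (iota : {rmorphism k -> K})
  (T : fin_space K (p ^ n)) :
  p \in [pchar K] -> is_torsor (const_Zm K (p ^ n)) T ->
  exists2 m, (m <= n)%N & defined_in_trdeg iota (const_Zm k (p ^ n)) T m.
Proof.
move=> pchar_K torT; set q := (p ^ n)%N in T torT *.
have [theta0 tr0] := torsor_trace1 torT.
have [a [I [b [theta [card_I size_a ringP sigmaP _ _ freeP _]]]]] :=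
  cyclic_tower (sigma := @torsor_gen _ _ _ torT) pchar_K tr0 (@torsor_gen_fixed _ _ _ torT).
have [L [iL [j [m [lemn jiL L_trdeg L_alg]]]]] := trdeg_subfield iota (fun l : 'I_n => a`_l).
pose im x := exists y, j y = x.
have im_ring : subring_pred im := rmorph_image_subring j.
have a_im c : c \in a -> im c.
  move=> /(nthP 0)[l la <-]; rewrite size_a in la.
  exact: L_alg (algebraic_over_mpoly_var iota (fun l : 'I_n => a`_l) (Ordinal la)).
have span_ring := ringP _ im_ring a_im; have span_sigma := sigmaP _ im_ring a_im.
pose e (l : 'I_q) : I := enum_val (cast_ord (esym card_I) l).
have e_bij : bijective e.
  exists (fun J => cast_ord card_I (enum_rank J)) => [l|J].
    by rewrite /e enum_valK cast_ordKV.
  by rewrite /e cast_ordK enum_rankK.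
pose Q : 'M[K]_(q, space_dim T) := \matrix_l (b (e l) : 'rV_(space_dim T)).
have Q_free : row_free Q.
  apply: inj_row_free => v v0; have [h eK hK] := e_bij.
  apply/rowP => l; rewrite [RHS]mxE -[l]eK.
  apply: (freeP (fun J => v 0 (h J))); rewrite (reindex e) /=; last exact: onW_bij.
  transitivity (v *m Q); last exact: v0.
  rewrite mulmx_sum_row; apply: eq_bigr => l' _.
  by rewrite eK rowK.
have Q_full : row_full Q by rewrite /row_full (eqP Q_free) (torsor_dim torT).
have spanP (u : torsor_ring torT) : span_over im b u -> exists x, map_mx j x *m Q = u.
  case=> c /choice[y yP] ->; exists (\row_l y (e l)).
  rewrite mulmx_sum_row (reindex e) /=; last exact: onW_bij.
  apply: eq_bigr => l _.
  by rewrite rowK !mxE yP.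
have span_row l : span_over im b (row l Q).
  by rewrite rowK; exact: span_over_mem.
have [S [torS isoS]] : exists S : fin_space L q,
    is_torsor (const_Zm L q) S /\ space_iso (space_bc j S) T.
  apply: (@descend_const_torsor L K j q q T Q (pinvmx Q)) => //.
  - exact: mulmxVp.
  - exact: mulVpmx.
  - exact/(spanP 1)/(subring_pred1 span_ring).
  - move=> l l'; apply: (spanP ((row l Q : torsor_ring torT) * row l' Q)).
    exact: subring_predM (span_row l) (span_row l').
  - move=> c; have /choice[x xP] l : exists x, map_mx j x *m Q
        = row l Q *m action_mx (@coact_basis K q T) (delta_mx c 0).
      have -> : row l Q *m action_mx (@coact_basis K q T) (delta_mx c 0)
          = iter c (@torsor_gen _ _ _ torT) (row l Q).
        rewrite iter_torsor_gen; congr (_ *m torsor_act _ _).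
        by apply: val_inj; rewrite /= modn_small.
      apply: spanP; elim: (c : nat) => [|d IHd] /=; first exact: span_row.
      exact: span_sigma.
    exists (\matrix_l x l); apply/row_matrixP => l.
    by rewrite !row_mul -map_row rowK xP.
exists m => //; exists L, iL, j; split=> //.
by exists S => //; rewrite hopf_bc_const.
Qed.

(** * Verschiebung on points *)

Section Dual.
Variables (F : fieldType) (n : nat) (G : fin_hopf F n).

Definition is_com_coalg : Prop :=
  [/\ is_comodule G (comul_basis G), is_commutative G & counit G != 0].

Lemma convol_action g h : convol G g h = action_mx (comul_basis G) h *m g.
Proof.
apply/colP => r; rewrite convolE mxE; apply: eq_bigr => t _.
by rewrite mxE mxE mulr_suml; apply: eq_bigr => s _; ring.
Qed.

Lemma mul_dualE u v : mul_alg (cartier_dual G) u v = (convol G u^T v^T)^T.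
Proof. by rewrite /convol !trmxK. Qed.

Hypothesis G_co : is_com_coalg.

Lemma convolC g h : convol G g h = convol G h g.
Proof.
have [_ G_comm _] := G_co; apply/colP => r; rewrite !convolE exchange_big.
apply: eq_bigr => s _; apply: eq_bigr => t _.
by rewrite -{1}(G_comm r) mxE [g _ _ * _]mulrC.
Qed.

Lemma convolA g h l : convol G g (convol G h l) = convol G (convol G g h) l.
Proof.
have [G_comod _ _] := G_co.
rewrite [RHS]convol_action [convol G g h]convol_action mulmxA.
by rewrite (action_mx_convol _ _ G_comod) -convol_action.
Qed.

Lemma convol1r g : convol G g (counit G) = g.
Proof. by have [G_comod _ _] := G_co; rewrite convol_action (action_mx_counit G_comod) mul1mx. Qed.

Lemma convol1l g : convol G (counit G) g = g.
Proof. by rewrite convolC convol1r. Qed.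

Lemma dual_com_alg : is_com_alg (cartier_dual G).
Proof.
split=> [u v w|u v|u]; rewrite !mul_dualE.
- by rewrite (trmxK (convol G u^T v^T)) (trmxK (convol G v^T w^T)) convolA.
- by rewrite convolC.
- by rewrite (trmxK (counit G)) convol1l trmxK.
Qed.

Lemma dual_nz : one_alg (cartier_dual G) != 0.
Proof.
have [_ _ G_nz] := G_co; apply: contra_neq G_nz => one0.
by apply: trmx_inj; rewrite linear0.
Qed.

Definition dual_ring := alg_ring dual_com_alg dual_nz.
HB.instance Definition _ := GRing.ComAlgebra.on dual_ring.

Definition convol_exp (g : 'cV[F]_n) (m : nat) : 'cV[F]_n := iter m (convol G g) (counit G).

Lemma exp_dualE (u : dual_ring) m : exp_alg (cartier_dual G) u m = u ^+ m.
Proof.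
rewrite /exp_alg; elim: m => //= m ->.
by rewrite exprS.
Qed.

Lemma convol_expE g m : convol_exp g m = ((g^T : dual_ring) ^+ m : 'rV[F]_n)^T.
Proof.
rewrite -exp_dualE /exp_alg /convol_exp; elim: m => [|m IHm]; first by rewrite /= trmxK.
by rewrite !iterS IHm mul_dualE (trmxK (convol _ _ _)) trmxK.
Qed.

Lemma convol_expM g m m' : convol_exp (convol_exp g m) m' = convol_exp g (m * m').
Proof. by rewrite !convol_expE trmxK exprM. Qed.

End Dual.

Lemma is_com_coalg_bc (F K : fieldType) (f : {rmorphism F -> K}) n (G : fin_hopf F n) :
  is_com_coalg G -> is_com_coalg (hopf_bc f G).
Proof.
case=> [[comulM comul1] comulC G_nz]; split=> [|i|] /=; last by rewrite map_mx_eq0.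
  split=> [i b t s|i] /=; last by rewrite -map_mxM comul1 map_delta_mx.
  transitivity (f (\sum_a comul_basis G i a s * comul_basis G a b t)).
    by rewrite rmorph_sum; apply: eq_bigr => a _; rewrite rmorphM !mxE.
  by rewrite comulM rmorph_sum; apply: eq_bigr => r _; rewrite rmorphM !mxE.
by rewrite map_trmx comulC.
Qed.

Lemma group_scheme_com_coalg (F : fieldType) n (G : fin_hopf F n) :
  is_group_scheme G -> is_commutative G -> is_com_coalg G.
Proof.
case=> _ [G_comod _] _ [G1 _] _ G_comm; split=> //.
apply/eqP => G0; have := G1; rewrite G0 mulmx0 => /matrixP/(_ 0 0)/eqP.
by rewrite !mxE eqxx eq_sym oner_eq0.
Qed.

Lemma map_convol_exp (F K : fieldType) (f : {rmorphism F -> K}) n (G : fin_hopf F n) g m :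
  map_mx f (convol_exp G g m) = convol_exp (hopf_bc f G) (map_mx f g) m.
Proof. by elim: m => //= m IHm; rewrite map_convol -IHm. Qed.

Section VerschiebungPoints.
Variables (p : nat) (k K : fieldType) (f : {rmorphism k -> K}).
Variables (pchar_k : p \in [pchar k]) (pchar_K : p \in [pchar K]).

Local Notation Fr := (map_mx (pFrobenius_aut pchar_K)).

Lemma verschiebung_convol n (G : fin_hopf k n) (g : 'cV[K]_n) : is_com_coalg G ->
  map_mx f (verschiebung p G) *m Fr g = convol_exp (hopf_bc f G) g p.
Proof.
move=> G_co; have GK_co := is_com_coalg_bc f G_co; rewrite (convol_expE GK_co).
apply: trmx_inj; rewrite trmxK trmx_mul.
have g_sum : g^T = \sum_i g i 0 *: delta_mx 0 i.
  by rewrite {1}[g^T]row_sum_delta; apply: eq_bigr => i _; rewrite mxE.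
pose R := dual_ring GK_co.
have pchar_R : p \in [pchar R] by rewrite pchar_lalg.
transitivity (\sum_i (g i 0 *: (delta_mx 0 i : R)) ^+ p : R); last first.
  by rewrite g_sum -(pFrobenius_autE pchar_R) [RHS]rmorph_sum.
rewrite mulmx_sum_row; apply: eq_bigr => i _; rewrite exprZn !mxE; congr (_ *: _).
rewrite -exp_dualE /verschiebung map_trmx trmxK -map_row rowK /exp_alg.
elim: (p) => [|m IHm]; first by rewrite /= map_trmx.
rewrite !iterS -IHm !mul_dualE -(map_trmx f (convol _ _ _)) map_convol.
by rewrite -!map_trmx map_delta_mx.
Qed.

Lemma hopf_bc_twist n (G : fin_hopf k n) :
  hopf_bc f (frob_twist pchar_k G) = hopf_bc (pFrobenius_aut pchar_K) (hopf_bc f G).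
Proof.
rewrite /frob_twist; pose h : {rmorphism k -> K} := f \o pFrobenius_aut pchar_k.
rewrite (hopf_bc_comp (h := h)) // (hopf_bc_comp (h := h)) // => x /=.
by rewrite !pFrobenius_autE rmorphXn.
Qed.

Lemma verschiebung_iter_convol m n (G : fin_hopf k n) (g : 'cV[K]_n) : is_com_coalg G ->
  map_mx f (verschiebung_iter pchar_k m G) *m iter m Fr g
  = convol_exp (hopf_bc f G) g (p ^ m).
Proof.
elim: m G g => [|m IHm] G g G_co.
  rewrite /= map_scalar_mx rmorph1 mul1mx.
  exact: esym (convol1r (is_com_coalg_bc f G_co) g).
rewrite iterSr /= map_mxM -mulmxA IHm; last exact: is_com_coalg_bc.
rewrite hopf_bc_twist -map_convol_exp verschiebung_convol //.
by rewrite (convol_expM (is_com_coalg_bc f G_co)) expnSr.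
Qed.

Lemma one_twist_iter m n (G : fin_hopf k n) (g : 'cV[K]_n) :
  map_mx f (one_alg G) *m g = 1 ->
  map_mx f (one_alg (iter m (@frob_twist p k pchar_k n) G)) *m iter m Fr g = 1.
Proof.
move=> g1; elim: m => //= m IHm.
rewrite -[map_mx f _]/(one_alg (hopf_bc f (frob_twist pchar_k _))) hopf_bc_twist /=.
by rewrite -map_mxM IHm map_scalar_mx rmorph1.
Qed.

Lemma iter_Fr_unit m n (M : 'M[K]_n) : M \in unitmx -> iter m Fr M \in unitmx.
Proof. by move=> M_unit; elim: m => //= m IHm; rewrite map_unitmx. Qed.

Lemma verschiebung_trivialP m n (G : fin_hopf k n) (M : 'M[K]_n) :
  is_com_coalg G -> M \in unitmx -> (forall c, map_mx f (one_alg G) *m col c M = 1) ->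
  (forall c, convol_exp (hopf_bc f G) (col c M) (p ^ m) = map_mx f (counit G)) ->
  verschiebung_iter_trivial pchar_k m G.
Proof.
move=> G_co M_unit M1 M_exp; apply: (map_mx_inj (f := f)).
apply: (eq_mx_points (iter_Fr_unit m M_unit)) => c.
have -> : col c (iter m Fr M) = iter m Fr (col c M).
  by elim: (m) => //= l <-; rewrite map_col.
by rewrite verschiebung_iter_convol // M_exp map_mxM -mulmxA one_twist_iter // mulmx1.
Qed.

End VerschiebungPoints.

(** * The constant group scheme Z/q *)

Section ConstantGroupScheme.
Variables (F : fieldType) (q : nat).
Hypothesis q_gt0 : (0 < q)%N.

Local Notation G := (const_Zm F q).

Definition residue k : 'I_q := Ordinal (ltn_pmod k q_gt0).

Lemma const_comul_entry (r a b : 'I_q) :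
  comul_basis G r a b = (ord_add_mod a b == r)%:R.
Proof. by rewrite mxE. Qed.

Lemma const_commutative : is_commutative G.
Proof. by move=> r; apply/matrixP => a b; rewrite !mxE addnC. Qed.

Lemma sum_delta (f : 'I_q -> F) (a : 'I_q) : \sum_b (a == b)%:R * f b = f a.
Proof.
rewrite (bigD1 a) //= eqxx mul1r big1 ?addr0 // => b ba.
by rewrite eq_sym (negPf ba) mul0r.
Qed.

Lemma const_comodule : is_comodule G (comul_basis G).
Proof.
split=> [i b t s|i].
  rewrite (eq_bigr (fun a : 'I_q => (ord_add_mod b t == a)%:R * comul_basis G i a s)).
    rewrite sum_delta [RHS](eq_bigr (fun r : 'I_q =>
        (ord_add_mod t s == r)%:R * comul_basis G i b r)); last first.
      by move=> r _; rewrite mulrC (const_comul_entry r).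
    rewrite sum_delta !const_comul_entry; congr (_ == _)%:R.
    by apply: val_inj; rewrite /= modnDml modnDmr addnA.
  by move=> a _; rewrite mulrC (const_comul_entry a).
apply/colP => a; rewrite mxE.
rewrite (eq_bigr (fun b : 'I_q => (residue 0 == b)%:R * comul_basis G i a b)).
  rewrite sum_delta const_comul_entry [RHS]mxE andbT; congr (_ == _)%:R.
  by apply: val_inj; rewrite /= mod0n addn0 modn_small.
by move=> b _; rewrite mulrC; congr (_ * _); rewrite mxE -val_eqE /= mod0n eq_sym.
Qed.

Lemma const_com_alg : is_com_alg G.
Proof.
split=> [u v w|u v|u]; rewrite !prod_algE; apply/rowP => c; rewrite !mxE.
- by rewrite mulrA.
- by rewrite mulrC.
- by rewrite mul1r.
Qed.

Lemma col_const_action (a b : 'I_q) :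
  col b (action_mx (comul_basis G) (delta_mx a 0)) = delta_mx (ord_add_mod b a) 0.
Proof.
apply/colP => r; rewrite mxE mxE -colE !mxE andbT eq_sym.
by rewrite -val_eqE.
Qed.

Lemma const_group_scheme : is_group_scheme G.
Proof.
split.
- exact: const_com_alg.
- split=> [|i]; first exact: const_comodule.
  by rewrite const_commutative; case: const_comodule.
- apply/(is_alg_hom2_points (unitmx1 F q) (@const_point F q)) => a.
  rewrite colE mul1mx; apply/is_alg_hom_prodP => b; rewrite col_const_action.
  exact: prod_alg_point.
- have -> : counit G = delta_mx (residue 0) 0 by apply: counit_const; rewrite /= mod0n.
  exact: prod_alg_point.
exists (\matrix_(l, c) ((l + c) %% q == 0)%N%:R) => i.
set S := \matrix_(l, c) _.
have mul_diag (X : 'M[F]_q) c : mul_tensor G X 0 c = X c c.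
  rewrite -{1}[X]mulmx1 mul_tensor_mul summxE (bigD1 c) //= [X in _ + X]big1 ?addr0.
    rewrite summxE (bigD1 c) //= big1 ?addr0 => [|d dc].
      by rewrite prod_algE !mxE !eqxx !mulr1.
    by rewrite prod_algE !mxE (negPf dc) !mulr0.
  move=> d dc; rewrite summxE big1 // => l _.
  by rewrite prod_algE !mxE (eq_sym c d) (negPf dc) mul0r mulr0.
have opp_entry (l c : 'I_q) : S l c = (residue (q - c) == l)%:R.
  rewrite mxE; congr (_%:R); congr nat_of_bool.
  have cq := ltn_ord c; have lq := ltn_ord l.
  rewrite -val_eqE /=; apply/eqP/eqP => [lc|<-].
    have [c0|c0] := posnP c.
      by move: lc; rewrite c0 addn0 subn0 modnn modn_small.
    have e : (l + c = q)%N.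
      move/eqP: lc => /dvdnP[[|[|m]]] e; last by exfalso; rewrite !mulSn in e; lia.
        by exfalso; lia.
      by rewrite e mul1n.
    by rewrite (_ : (q - c)%N = l) ?modn_small // -{1}e addnK.
  by rewrite modnDml subnK ?modnn // ltnW.
have sum_S (c : 'I_q) : \sum_l (residue (q - c) == l)%:R * comul_basis G i l c = counit G i 0.
  rewrite sum_delta const_comul_entry [RHS]mxE -val_eqE /= modnDml subnK ?modnn.
    by rewrite eq_sym.
  exact: ltnW.
split; apply/rowP => c; rewrite mul_diag [RHS]mxE [X in _ * X]mxE mulr1 -(sum_S c) mxE.
  by apply: eq_bigr => l _; rewrite mxE opp_entry.
by apply: eq_bigr => l _; rewrite opp_entry mulrC -{1}const_commutative mxE.
Qed.

Lemma const_act_residue d (rho : 'I_d -> 'M[F]_(d, q)) k : is_comodule G rho ->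
  action_mx rho (delta_mx (residue k.+1) 0)
  = action_mx rho (delta_mx (residue 1) 0) *m action_mx rho (delta_mx (residue k) 0).
Proof.
move=> rho_co; rewrite (action_mx_convol _ _ rho_co) convol_const.
by congr (action_mx _ (delta_mx _ _)); apply: val_inj; rewrite /= modnDm addn1.
Qed.

Lemma const_unipotent p n : p \in [pchar F] -> q = (p ^ n)%N -> is_unipotent G.
Proof.
move=> pchar_F qpn [//|d] rho _ rho_co.
pose R : 'M[F]_d.+1 := action_mx rho (delta_mx (residue 1) 0).
have R_exp k : R ^+ k = action_mx rho (delta_mx (residue k) 0).
  elim: k => [|k IHk]; last by rewrite exprS IHk; exact: esym (const_act_residue k rho_co).
  by rewrite -(counit_const F (a := residue 0)) ?(action_mx_counit rho_co) //= mod0n.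
have Rq : R ^+ q = 1.
  rewrite R_exp -(counit_const F (a := residue q)) ?(action_mx_counit rho_co) //=.
  by rewrite modnn.
have R1q : (R - 1) ^+ q = 0.
  by rewrite [in LHS]qpn (mx_sub1_exp_pchar _ _ pchar_F) -qpn Rq subrr.
have /det0P[v v0 vR] : \det (R - 1) == 0.
  rewrite -[_ == 0]negbK -unitfE -/(unitmx _); apply/negP => R1_unit.
  have : (R - 1) ^+ q \is a GRing.unit by rewrite unitrX.
  by rewrite R1q unitr0.
exists v => //; apply: (eq_mx_points (unitmx1 F q)) => c.
have vRv : v *m R = v by move/eqP: vR; rewrite mulmxBr mulmx1 subr_eq0 => /eqP.
rewrite linear_ext_mul -mulmxA; have [-> _] := const_point F c.
rewrite mulmx1 colE mul1mx; congr (_^T).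
have -> : c = residue c by apply: val_inj; rewrite /= modn_small.
rewrite -R_exp; elim: (c : nat) => [|k IHk]; first by rewrite expr0 mulmx1.
by rewrite exprS mulmxA vRv.
Qed.

Lemma const_etale : is_etale G.
Proof.
exists F, idfun, 1%:M; split; last by exists id => u; rewrite mulmx1.
rewrite -[alg_bc _ _]/(hopf_alg (hopf_bc _ _)) hopf_bc_const.
by split=> [|u v]; rewrite !mulmx1.
Qed.

Lemma const_convol_exp m :
  convol_exp G (delta_mx (residue 1) 0) m = delta_mx (residue m) 0.
Proof.
elim: m => [|m IHm]; first by apply: counit_const; rewrite /= mod0n.
rewrite /convol_exp iterS -/(convol_exp _ _ _) IHm convol_const.
by congr (delta_mx _ _); apply: val_inj; rewrite /= modnDm add1n.
Qed.

End ConstantGroupScheme.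

Lemma const_verschiebung_trivial (F : fieldType) (p : nat) (pchar_F : p \in [pchar F]) n m :
  verschiebung_iter_trivial pchar_F m (const_Zm F (p ^ n)) -> (n <= m)%N.
Proof.
have p_pr := pcharf_prime pchar_F; have q_gt0 : (0 < p ^ n)%N by rewrite expn_gt0 prime_gt0.
set q := (p ^ n)%N in q_gt0 *; pose g : 'cV[F]_q := delta_mx (residue q_gt0 1) 0.
have G_co : is_com_coalg (const_Zm F q).
  apply: group_scheme_com_coalg; first exact: const_group_scheme.
  exact: const_commutative.
have iter_g l : iter l (map_mx (pFrobenius_aut pchar_F)) g = g.
  by elim: l => //= l ->; rewrite map_delta_mx.
move=> /(congr1 (fun X => map_mx idfun X *m iter m (map_mx (pFrobenius_aut pchar_F)) g)).
rewrite verschiebung_iter_convol // map_mxM -mulmxA.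
rewrite one_twist_iter; last first.
  rewrite map_const_mx rmorph1; have [+ _] := prod_alg_point F (residue q_gt0 1).
  by [].
rewrite mulmx1 hopf_bc_const const_convol_exp => /colP/(_ (residue q_gt0 (p ^ m))).
rewrite !mxE !eqxx /=; have [/eqP qm _|_ /eqP] := eqVneq (p ^ m %% q)%N 0%N.
  by rewrite -(dvdn_Pexp2l _ _ (prime_gt1 p_pr)).
by rewrite oner_eq0.
Qed.

(** * Unipotent and split group schemes *)

Section Unipotent.
Variables (k K : fieldType) (f : {rmorphism k -> K}) (n : nat) (G : fin_hopf k n).
Hypothesis G_unip : is_unipotent G.

Lemma action_mx_sum (F : fieldType) m n1 (rho : 'I_m -> 'M[F]_(n1, n)) g :
  action_mx rho g = \sum_s g s 0 *: action_mx rho (delta_mx s 0).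
Proof.
rewrite {1}[g](_ : _ = \sum_s g s 0 *: delta_mx s 0) ?linear_sum /=.
  by apply: eq_bigr => s _; rewrite linearZ.
rewrite {1}[g]matrix_sum_delta; apply: eq_bigr => s _.
by rewrite big_ord1.
Qed.

Lemma strictly_lower_exp d (c : 'M[K]_(d, 1)) (N : 'M[K]_d) m :
  (block_mx 0 0 c N : 'M_(1 + d)) ^+ m.+1 = block_mx 0 0 (N ^+ m *m c) (N ^+ m.+1).
Proof.
elim: m => [|m IHm]; first by rewrite expr1 expr0 mul1mx.
rewrite exprSr IHm [LHS]mulmx_block !mul0mx !mulmx0 !addr0 !add0r.
by rewrite [N ^+ m.+2]exprSr.
Qed.

(* The action is unitriangular: split off the line of a fixed vector and pass to
   the quotient comodule. *)
Lemma unipotent_nilpotent d (rho : 'I_d -> 'M[k]_(d, n)) (g : 'cV[K]_n) :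
  is_comodule G rho -> map_mx f (one_alg G) *m g = 1 ->
  (action_mx (fun i => map_mx f (rho i)) g - 1%:M) ^+ d = 0.
Proof.
elim: d rho => [|d IHd] rho rho_co g1; first by apply/matrixP => -[].
have [v v_neq0 v_fix] := G_unip (isT : (0 < d.+1)%N) rho_co.
have [P P_unit [a a_neq0 defv]] : exists2 P : 'M[k]_(1 + d), P \in unitmx &
    exists2 a, a != 0 & v = a *: row 0 P.
  exists (row_ebase v); first exact: row_ebase_unit.
  exists (col_ebase v 0 0).
    apply: contra_neq v_neq0 => a0; rewrite -(mulmx_ebase v).
    by rewrite [col_ebase v]mx11_scalar a0 raddf0 !mul0mx.
  rewrite -{1}(mulmx_ebase v) [col_ebase v]mx11_scalar -mulmxA mul_scalar_mx.
  rewrite [X in _ *: (X *m _)](_ : _ = delta_mx 0 0) ?mxE ?eqxx ?mulr1n -?rowE //.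
  by apply/rowP => i; rewrite !mxE rank_rV v_neq0 /= andbT eq_sym.
pose R h := P *m action_mx rho h *m invmx P.
have R_mul h h' : R h *m R h' = R (convol G h' h).
  rewrite /R -(action_mx_convol _ _ rho_co) !mulmxA; congr (_ *m _).
  by rewrite -!mulmxA (mulmxA (invmx P)) mulVmx // mul1mx.
have R_sum h : R h = \sum_s h s 0 *: R (delta_mx s 0).
  rewrite /R action_mx_sum mulmx_sumr mulmx_suml; apply: eq_bigr => s _.
  by rewrite -scalemxAr -scalemxAl.
have row_R h : row 0 (R h) = (one_alg G *m h) 0 0 *: delta_mx 0 0.
  have vact : v *m action_mx rho h = (one_alg G *m h) 0 0 *: v.
    apply: trmx_inj; rewrite -linear_ext_mul v_fix -mulmxA.
    by rewrite {1}[one_alg G *m h]mx11_scalar mul_mx_scalar linearZ.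
  have Pact : row 0 P *m action_mx rho h = (one_alg G *m h) 0 0 *: row 0 P.
    apply: (scalerI a_neq0); rewrite scalemxAl -defv vact defv.
    by rewrite !scalerA mulrC.
  rewrite /R !row_mul Pact -scalemxAl; congr (_ *: _).
  by rewrite -row_mul mulmxV // row1.
have R_ur h : ursubmx (R h : 'M_(1 + d)) = 0.
  apply/rowP => j; have /rowP/(_ (rshift 1 j)) := row_R h.
  rewrite !mxE; have -> : lshift d (0 : 'I_1) = 0 by apply: val_inj.
  by move=> ->; rewrite /= mulr0.
pose rho' := @coaction_of k n 1%:M d (fun s => drsubmx (R (delta_mx s 0) : 'M_(1 + d))).
have act' h : action_mx rho' h = drsubmx (R h : 'M_(1 + d)).
  apply/matrixP => i b; rewrite action_mx_sum summxE R_sum !mxE summxE.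
  apply: eq_bigr => s _; rewrite [LHS]mxE [RHS]mxE; congr (_ * _).
  have := action_coaction_of (unitmx1 k n)
    (fun s => drsubmx (R (delta_mx s 0) : 'M_(1 + d))) s.
  by rewrite colE mul1mx => ->; rewrite !mxE.
have dr_mul (X Y : 'M[k]_(1 + d)) : ursubmx Y = 0 ->
    drsubmx (X *m Y) = drsubmx X *m drsubmx Y.
  move=> Y0; rewrite -{1}[X]submxK -{1}[Y]submxK mulmx_block block_mxKdr Y0.
  by rewrite mulmx0 add0r.
have rho'_co : is_comodule G rho'.
  apply: (is_comodule_points (unitmx1 k n)) => [c c'|].
    by rewrite !act' -R_mul dr_mul.
  rewrite act' /R (action_mx_counit rho_co) mulmx1 mulmxV //.
  by rewrite (scalar_mx_block 1 d 1) block_mxKdr.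
have {}IHd := IHd rho' rho'_co g1.
pose PK : 'M[K]_(1 + d) := map_mx f P; have PK_unit : PK \in unitmx by rewrite map_unitmx.
pose act : 'M[K]_(1 + d) := action_mx (fun i => map_mx f (rho i)) g.
pose RK := PK *m act *m invmx PK.
have delta_map s : delta_mx s 0 = map_mx f (delta_mx s 0) :> 'cV_n by rewrite map_delta_mx.
have RK_sum : RK = \sum_s g s 0 *: map_mx f (R (delta_mx s 0)).
  rewrite /RK /act action_mx_sum mulmx_sumr mulmx_suml; apply: eq_bigr => s _.
  by rewrite -scalemxAr -scalemxAl delta_map -map_action_mx /PK -map_invmx -!map_mxM.
have row_RK : row 0 RK = delta_mx 0 0.
  transitivity (\sum_s g s 0 *: (f (one_alg G 0 s) *: (delta_mx 0 0 : 'rV[K]_(1 + d)))).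
    rewrite RK_sum linear_sum; apply: eq_bigr => s _; rewrite linearZ /=; congr (_ *: _).
    by rewrite -map_row row_R map_mxZ map_delta_mx -colE mxE.
  under eq_bigr => s _ do rewrite scalerA.
  rewrite -scaler_suml -[RHS]scale1r; congr (_ *: _).
  transitivity ((map_mx f (one_alg G) *m g) 0 0); last by rewrite g1 mxE.
  by rewrite mxE; apply: eq_bigr => s _; rewrite mxE mulrC.
have ord0_split : lshift d (0 : 'I_1) = 0 by apply: val_inj.
have RK_block : RK - 1%:M = block_mx 0 0 (dlsubmx RK)
    (action_mx (fun i => map_mx f (rho' i)) g - 1%:M).
  rewrite -{1}[RK]submxK (scalar_mx_block 1 d 1) opp_block_mx add_block_mx oppr0 !addr0.
  congr block_mx.
  - apply/matrixP => i j; rewrite !ord1 !mxE ord0_split.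
    by have /rowP/(_ 0) := row_RK; rewrite !mxE => ->; rewrite subrr.
  - apply/rowP => j; have /rowP/(_ (rshift 1 j)) := row_RK.
    by rewrite !mxE ord0_split => ->.
  - by rewrite subr0.
  congr (_ - _); rewrite RK_sum action_mx_sum; apply/matrixP => i b.
  rewrite [LHS]mxE [LHS]mxE !summxE; apply: eq_bigr => s _.
  rewrite [LHS]mxE [RHS]mxE; congr (_ * _).
  by rewrite [LHS]mxE delta_map -map_action_mx [RHS]mxE act' !mxE.
have RK_nil : (RK - 1%:M) ^+ d.+1 = 0.
  rewrite RK_block strictly_lower_exp exprS IHd mul0mx.
  by rewrite [X in block_mx _ _ _ X]mulr0 block_mx0.
have conj m : PK *m (act - 1%:M) ^+ m = (RK - 1%:M) ^+ m *m PK.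
  elim: m => [|m IHm]; first by rewrite !expr0 mulmx1 mul1mx.
  rewrite exprSr mulmxA IHm [in RHS]exprSr -!mulmxA; congr (_ *m _).
  by rewrite mulmxBr mulmxBl mulmx1 mul1mx /RK mulmxKV.
have := conj d.+1; rewrite RK_nil mul0mx => /(congr1 (mulmx (invmx PK))).
by rewrite mulKmx // mulmx0.
Qed.

End Unipotent.

Lemma linear_eq_basis (F : fieldType) l (V : lmodType F) (h1 h2 : 'rV[F]_l -> V) :
  linear h1 -> linear h2 -> (forall i, h1 (delta_mx 0 i) = h2 (delta_mx 0 i)) -> h1 =1 h2.
Proof.
move=> h1_lin h2_lin h12 u.
have lin0 (h : 'rV[F]_l -> V) : linear h -> h 0 = 0.
  by move=> h_lin; have := h_lin (-1) 0 0; rewrite scaler0 addr0 scaleN1r addNr.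
rewrite [u]row_sum_delta; elim/big_rec: _ => [|i x _ IHx]; first by rewrite !lin0.
by rewrite h1_lin h2_lin h12 IHx.
Qed.

Section Bilinear.
Variables (F : fieldType) (m n : nat) (A : fin_alg F m) (B : fin_alg F n).

Lemma mul2_linearl Y : linear (mul2 A B ^~ Y).
Proof.
move=> a X X'; rewrite /mul2; rewrite scaler_sumr -big_split; apply: eq_bigr => i _.
rewrite scaler_sumr -big_split; apply: eq_bigr => j _.
rewrite scaler_sumr -big_split; apply: eq_bigr => r _.
rewrite scaler_sumr -big_split; apply: eq_bigr => l _ /=.
by rewrite !mxE mulrDl scalerDl scalerA mulrA.
Qed.

Lemma mul2_linearr X : linear (mul2 A B X).
Proof.
move=> a Y Y'; rewrite /mul2; rewrite scaler_sumr -big_split; apply: eq_bigr => i _.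
rewrite scaler_sumr -big_split; apply: eq_bigr => j _.
rewrite scaler_sumr -big_split; apply: eq_bigr => r _.
rewrite scaler_sumr -big_split; apply: eq_bigr => l _ /=.
by rewrite !mxE mulrDr scalerDl scalerA mulrCA.
Qed.

End Bilinear.

Lemma linear_ext_linear (F : fieldType) m n1 n2 (rho : 'I_m -> 'M[F]_(n1, n2)) :
  linear (linear_ext rho).
Proof.
move=> a u v; rewrite /linear_ext scaler_sumr -big_split; apply: eq_bigr => i _ /=.
by rewrite !mxE scalerDl scalerA.
Qed.

Lemma is_alg_hom2_bc (F K : fieldType) (f : {rmorphism F -> K}) l m n (C : fin_alg F l)
  (A : fin_alg F m) (B : fin_alg F n) (phi : 'I_l -> 'M[F]_(m, n)) :
  is_alg_hom2 C A B phi ->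
  is_alg_hom2 (alg_bc f C) (alg_bc f A) (alg_bc f B) (fun i => map_mx f (phi i)).
Proof.
case=> phi1 phiM; split; first by rewrite -map_linear_ext phi1 map_one2.
set phiK := fun i => _.
have phiK_lin : linear (linear_ext phiK) by exact: linear_ext_linear.
move=> u v; apply: (linear_eq_basis (h1 := fun u => linear_ext phiK (mul_alg (alg_bc f C) u v))
  (h2 := fun u => mul2 (alg_bc f A) (alg_bc f B) (linear_ext phiK u) (linear_ext phiK v))).
- by move=> a x y; rewrite mul_algDl mul_algZl phiK_lin.
- by move=> a x y; rewrite phiK_lin [LHS]mul2_linearl.
move=> i {u}; apply: (linear_eq_basis
  (h1 := fun v => linear_ext phiK (mul_alg (alg_bc f C) (delta_mx 0 i) v))
  (h2 := fun v => mul2 (alg_bc f A) (alg_bc f B) (linear_ext phiK (delta_mx 0 i))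
                    (linear_ext phiK v))).
- by move=> a x y; rewrite mul_algDr mul_algZr phiK_lin.
- by move=> a x y; rewrite phiK_lin mul2_linearr.
move=> j {v}; rewrite -!(map_delta_mx f) -map_mul_alg.
have extE w : linear_ext phiK (map_mx f w) = map_mx f (linear_ext phi w).
  by rewrite map_linear_ext.
by rewrite !extE phiM map_mul2.
Qed.

Lemma convol_point (F : fieldType) n (G : fin_hopf F n) g h :
  is_alg_hom2 G G G (comul_basis G) -> is_point G g -> is_point G h ->
  is_point G (convol G g h).
Proof.
move=> comul_hom [g1 gM] h_pt; have [h1 hM] := is_alg_hom_action comul_hom h_pt.
rewrite convol_action; split=> [|u v]; rewrite !mulmxA.
  by rewrite h1.
by rewrite hM gM !mulmxA.
Qed.

Lemma split_point (F : fieldType) n (A : fin_alg F n) (M : 'M[F]_n) g :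
  M \in unitmx -> is_alg_hom A (prod_alg F n) M -> is_point A g -> exists c, g = col c M.
Proof.
move=> M_unit [M1 MM] [g1 gM]; pose h := invmx M *m g.
have gE : g = M *m h by rewrite mulKVmx.
have h1 : const_mx 1 *m h = 1 by rewrite -g1 gE mulmxA M1.
have hM u v : mul_alg (prod_alg F n) u v *m h = (u *m h) *m (v *m h).
  rewrite -{1}[u](mulmxKV M_unit) -{1}[v](mulmxKV M_unit) -MM -mulmxA -gE gM.
  by rewrite /h !mulmxA.
have hh c d : h c 0 * h d 0 = (c == d)%:R * h c 0.
  have := congr1 (fun X : 'M_1 => X 0 0) (hM (delta_mx 0 c) (delta_mx 0 d)).
  rewrite mul_alg_delta /= -scalemxAl -!rowE.
  by rewrite [(_ *: row c h) 0 0]mxE [X in _ = X -> _]mxE big_ord1 !mxE => ->.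
have [c hc] : exists c, h c 0 != 0.
  apply: contrapT => no_c; have /eqP := congr1 (fun X : 'M_1 => X 0 0) h1.
  rewrite mxE big1 => [|c _]; first by rewrite mxE eq_sym oner_eq0.
  by rewrite (_ : h c 0 = 0) ?mulr0 //; apply/eqP; apply: contra_notT no_c => ?; exists c.
exists c; rewrite gE colE; congr (_ *m _); apply/colP => d; rewrite [RHS]mxE andbT.
have [->|dc] := eqVneq d c.
  by apply: (mulfI hc); rewrite hh eqxx mul1r mulr1.
by apply/(mulfI hc); rewrite hh eq_sym (negPf dc) mul0r mulr0.
Qed.

Section SplitGroup.
Variables (p : nat) (k K : fieldType) (f : {rmorphism k -> K}) (pchar_K : p \in [pchar K]).
Variables (n : nat) (G : fin_hopf k n) (M : 'M[K]_n).
Hypotheses (G_group : is_group_scheme G) (G_comm : is_commutative G).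
Hypotheses (G_unip : is_unipotent G) (n_gt1 : (1 < n)%N).
Hypotheses (M_unit : M \in unitmx) (M_hom : is_alg_hom (hopf_bc f G) (prod_alg K n) M).

Local Notation GK := (hopf_bc f G).

Lemma split_col_point c : is_point GK (col c M).
Proof. exact: (is_alg_hom_prodP _ _).1. Qed.

Lemma col_mx_inj : injective (fun c => col c M).
Proof.
move=> c d cd; have /colP/(_ c) : delta_mx c 0 = delta_mx d 0 :> 'cV[K]_n.
  by apply: (can_inj (mulKmx M_unit)); rewrite -!colE.
by rewrite !mxE eqxx andbT /=; case: eqP => // _ /eqP; rewrite oner_eq0.
Qed.

Let G_co : is_com_coalg G. Proof. exact: group_scheme_com_coalg. Qed.
Let GK_co : is_com_coalg GK. Proof. exact: is_com_coalg_bc. Qed.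

Lemma split_group_splitting :
  exists (mu : 'I_n -> 'I_n -> 'I_n) (u : 'I_n) e (H : finType) (act : H -> 'I_n -> H)
    (alpha : 'I_n -> 'I_(p ^ e)) pw (t0 : H),
  [/\ forall a b, convol GK (col a M) (col b M) = col (mu a b) M,
      counit GK = col u M,
      forall a, convol_exp GK (col a M) (p ^ e) = counit GK,
      (0 < e)%N &
      cyclic_splitting mu u act alpha pw].
Proof.
have p_pr := pcharf_prime pchar_K.
have [_ _ comul_hom counit_pt _] := G_group.
have comulK_hom : is_alg_hom2 GK GK GK (comul_basis GK) := is_alg_hom2_bc f comul_hom.
have /choice[mu2 mu2P] : forall ab : 'I_n * 'I_n,
    exists c, convol GK (col ab.1 M) (col ab.2 M) = col c M.
  move=> [a b]; apply: split_point M_unit M_hom _.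
  by apply: convol_point => //; exact: split_col_point.
pose mu a b := mu2 (a, b); have muP a b : convol GK (col a M) (col b M) = col (mu a b) M.
  exact: mu2P (a, b).
have [u uP] : exists u, counit GK = col u M.
  by apply: split_point M_unit M_hom _; exact: is_point_bc.
have muA : associative mu.
  by move=> a b c; apply: col_mx_inj; rewrite -!muP (convolA GK_co).
have mu1 : left_id u mu.
  by move=> a; apply: col_mx_inj; rewrite -muP -uP (convol1l GK_co).
have muC : commutative mu.
  by move=> a b; apply: col_mx_inj; rewrite -!muP (convolC GK_co).
have exp_mu a m : convol_exp GK (col a M) m = col (iter m (mu a) u) M.
  by elim: m => // m IHm; rewrite iterS -muP -IHm.
have [GK_comod _ _] := GK_co.
have exp_pn a : iter (p ^ n) (mu a) u = u.
  apply: col_mx_inj; rewrite -exp_mu -uP.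
  pose act := action_mx (comul_basis GK) (col a M).
  have act1 : (act - 1%:M) ^+ n = 0.
    have [comod _ _] := G_co; have [one_pt _] := split_col_point a.
    by have := unipotent_nilpotent G_unip comod one_pt.
  have act_exp m : act ^+ m = action_mx (comul_basis GK) (convol_exp GK (col a M) m).
    elim: m => [|m IHm]; first by rewrite expr0 (action_mx_counit GK_comod).
    by rewrite exprSr IHm [LHS](action_mx_convol _ _ GK_comod).
  have act_pn : act ^+ (p ^ n) = 1.
    case: (n) n_gt1 (act) act1 => // n' _ act' act1'; apply/eqP.
    rewrite -subr_eq0 -(mx_sub1_exp_pchar _ _ pchar_K) -[act' - 1]/(act' - 1%:M).
    rewrite -(subnK (ltnW (ltn_expl n'.+1 (prime_gt1 p_pr)))) exprD.
    by rewrite act1' mulr0.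
  rewrite -[LHS](convol1l GK_co) convol_action -act_exp act_pn.
  exact: mul1mx.
have [e [H [act [alpha [pw [t0 [exp_e H_split]]]]]]] :=
  table_cyclic_splitting p_pr muA mu1 muC exp_pn.
exists mu, u, e, H, act, alpha, pw, t0; split=> // [a|]; first by rewrite exp_mu exp_e.
case: e exp_e {act alpha pw H_split} => // exp_e.
have all_u a : a = u by rewrite -[RHS](exp_e a) /= muC mu1.
case: (n) n_gt1 (u) all_u => [|[|n']] // _ u' all_u'.
by have := congr1 val (etrans (all_u' ord_max) (esym (all_u' ord0))).
Qed.

End SplitGroup.

(** * Induced torsors *)

Section Blocks.
Variables (F : fieldType) (H : finType) (d : nat).

Definition block_proj (t : H) : 'M[F]_(#|H| * d, d) :=
  lin1_mx (fun u => row (enum_rank t) (vec_mx u : 'M_(#|H|, d))).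

Definition block_inj (t : H) : 'M[F]_(d, #|H| * d) :=
  lin1_mx (fun u : 'rV_d => mxvec (delta_mx (enum_rank t) 0 *m u)).

Fact block_projE t u : u *m block_proj t = row (enum_rank t) (vec_mx u).
Proof. by rewrite (mul_rV_lin1 (row (enum_rank t) \o vec_mx)). Qed.

Fact block_injE t u : u *m block_inj t = mxvec (delta_mx (enum_rank t) 0 *m u).
Proof. by rewrite (mul_rV_lin1 (mxvec \o mulmx (delta_mx (enum_rank t) 0))). Qed.

Lemma block_injK t t' : block_inj t *m block_proj t' = (t == t')%:R%:M.
Proof.
apply/row_matrixP => i; rewrite row_mul [row i (block_inj t)]rowE block_injE block_projE mxvecK.
rewrite mul_delta_mx; apply/rowP => l; rewrite !mxE (inj_eq enum_rank_inj).
rewrite (eq_sym t' t) (eq_sym l i).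
by case: (t == t'); case: (i == l).
Qed.

Lemma eq_block_proj m (X Y : 'M[F]_(m, #|H| * d)) :
  (forall t, X *m block_proj t = Y *m block_proj t) -> X = Y.
Proof.
move=> XY; apply/row_matrixP => i; apply: (can_inj vec_mxK); apply/row_matrixP => r.
have := congr1 (row i) (XY (enum_val r)).
by rewrite !row_mul !block_projE enum_valK.
Qed.

End Blocks.

(* The torsor induced from [T] along [pw]: its coordinate ring is the product of
   copies of that of [T] indexed by [H], and [c] acts by permuting the copies
   through [act] and by [alpha c] on each of them. *)
Section InducedTorsor.
Variables (F : fieldType) (q n : nat) (G : fin_hopf F n) (M : 'M[F]_n).
Hypotheses (M_unit : M \in unitmx) (M_pt : forall c, is_point G (col c M)).
Variables (mu : 'I_n -> 'I_n -> 'I_n) (u : 'I_n).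
Hypothesis muP : forall a b, convol G (col a M) (col b M) = col (mu a b) M.
Hypothesis uP : counit G = col u M.
Variables (H : finType) (act : H -> 'I_n -> H) (alpha : 'I_n -> 'I_q) (pw : 'I_q -> 'I_n).
Variable t0 : H.
Hypothesis H_split : cyclic_splitting mu u act alpha pw.
Variables (T : fin_space F q) (torT : is_torsor (const_Zm F q) T).

Local Notation d := (space_dim T).
Local Notation D := (#|H| * space_dim T)%N.
Local Notation E := (@block_proj F H (space_dim T)).
Local Notation J := (@block_inj F H (space_dim T)).

Definition induced_alg : fin_alg F D :=
  FinAlg (fun x y => \sum_t mul_alg T (row x (E t)) (row y (E t)) *m J t)
    (\sum_t one_alg T *m J t).

Definition induced_act (c : 'I_n) : 'M[F]_D :=
  \sum_t E (act t c) *m torsor_act T (alpha c) *m J t.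

Definition induced_torsor : fin_space F n :=
  FinSpace induced_alg (coaction_of M induced_act).

Lemma sum_block_inj m (X : H -> 'M[F]_(m, d)) t : (\sum_t' X t' *m J t') *m E t = X t.
Proof.
rewrite mulmx_suml (bigD1 t) //= -mulmxA block_injK eqxx mulmx1 big1 ?addr0 // => t' t't.
by rewrite -mulmxA block_injK (negPf t't) raddf0 mulmx0.
Qed.

Lemma induced_mul_proj (v w : 'rV[F]_D) t :
  mul_alg induced_alg v w *m E t = mul_alg T (v *m E t) (w *m E t).
Proof.
transitivity (\sum_x \sum_y (v 0 x * w 0 y) *: mul_alg T (row x (E t)) (row y (E t))).
  rewrite mul_algE mulmx_suml; apply: eq_bigr => x _.
  by rewrite mulmx_suml; apply: eq_bigr => y _; rewrite -scalemxAl sum_block_inj.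
rewrite !mulmx_sum_row mul_alg_suml; apply: eq_bigr => x _.
by rewrite mul_alg_sumr; apply: eq_bigr => y _; rewrite mul_algZl mul_algZr scalerA.
Qed.

Lemma induced_one_proj t : one_alg induced_alg *m E t = one_alg T.
Proof. exact: (sum_block_inj (fun=> one_alg T)). Qed.

Lemma induced_act_proj c t :
  induced_act c *m E t = E (act t c) *m torsor_act T (alpha c).
Proof. exact: (sum_block_inj (fun t => E (act t c) *m torsor_act T (alpha c))). Qed.

Lemma induced_proj_hom t : is_alg_hom induced_alg T (E t).
Proof. by split=> [|v w]; [exact: induced_one_proj|exact: induced_mul_proj]. Qed.

Lemma card_splitting : (#|H| * q)%N = n.
Proof. by apply: cyclic_splitting_card H_split _; apply/card_gt0P; exists t0. Qed.

Lemma is_torsor_induced : is_torsor G induced_torsor.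
Proof.
have [T_gt0 [mA mC m1] T_comod _ T_bij] := torT.
have dq := torsor_dim torT.
have Dn : D = n by rewrite dq card_splitting.
apply: (is_torsor_points M_unit M_pt) => //=.
- by rewrite -card_splitting -dq muln_gt0 T_gt0 andbT; apply/card_gt0P; exists t0.
- split=> [v w x|v w|v]; apply: eq_block_proj => t; rewrite !induced_mul_proj.
  + exact: mA.
  + exact: mC.
  + by rewrite induced_one_proj m1.
- move=> c; rewrite action_coaction_of //.
  have [s1 sM] := torsor_act_hom torT (alpha c).
  split=> [|v w]; apply: eq_block_proj => t; rewrite -?mulmxA.
    by rewrite induced_act_proj mulmxA !induced_one_proj s1.
  by rewrite induced_mul_proj induced_act_proj mulmxA induced_mul_proj sM -!mulmxA induced_act_proj.
- move=> c c'; rewrite !muP !action_coaction_of //; apply: eq_block_proj => t.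
  rewrite -mulmxA induced_act_proj mulmxA induced_act_proj induced_act_proj.
  rewrite (split_actM H_split) -mulmxA (torsor_act_add torT); congr (_ *m torsor_act T _).
  apply: val_inj; rewrite /= -(split_alphaM H_split) modn_small //.
- rewrite uP action_coaction_of //; apply: eq_block_proj => t.
  rewrite induced_act_proj (split_act1 H_split) (torsor_act0 torT) ?mulmx1 ?mul1mx //.
  exact: split_alpha1 H_split.
move=> X X0.
have X_block t t' : (E t)^T *m X *m E t' = 0.
  apply: (bij_inj T_bij).
  have -> : torsor_map (const_Zm F q) (0 : 'M_d) = 0.
    exact: (linear0 (@torsor_map F q (const_Zm F q) T)).
  apply: (eq_mx_points (unitmx1 F q)) => a; rewrite colE mul1mx mul0mx.
  rewrite torsor_map_point; last exact: prod_alg_point.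
  apply: trmx_inj; rewrite trmxK linear0.
  have [c [[ct ca] _]] := split_unique H_split t t' a.
  rewrite -mulmxA -[_ *m action_mx _ _]/(E t' *m torsor_act T a) -ct -ca -induced_act_proj.
  rewrite mulmxA -[_ *m X *m _]mulmxA -(mul_tensor_hom _ (induced_proj_hom t)).
  by have := X0 c; rewrite action_coaction_of // => ->; rewrite mul0mx.
apply: eq_block_proj => t'; rewrite mul0mx; apply: trmx_inj; apply: eq_block_proj => t.
by apply: trmx_inj; rewrite linear0 mul0mx linear0 trmx_mul trmxK mulmxA X_block.
Qed.

(* Identifies the functions on [T] with the [H]-invariants. *)
Definition induced_diag : 'M[F]_(d, D) := \sum_t J t.

Lemma induced_diag_proj t : induced_diag *m E t = 1%:M.
Proof.
rewrite -(sum_block_inj (fun=> 1%:M) t); congr (_ *m _).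
by apply: eq_bigr => t' _; rewrite mul1mx.
Qed.

Lemma induced_diag_hom : is_alg_hom T induced_alg induced_diag.
Proof.
split=> [|v w]; apply: eq_block_proj => t.
  by rewrite -mulmxA induced_diag_proj mulmx1 induced_one_proj.
by rewrite induced_mul_proj -!mulmxA induced_diag_proj !mulmx1.
Qed.

Lemma induced_diag_act a :
  induced_diag *m induced_act (pw a) = torsor_act T a *m induced_diag.
Proof.
apply: eq_block_proj => t; rewrite -!mulmxA induced_act_proj induced_diag_proj mulmx1.
by rewrite mulmxA induced_diag_proj mul1mx (split_alpha_pw H_split).
Qed.

Definition induced_trace : 'M[F]_D := \sum_(c | alpha c == 0%N :> nat) induced_act c.

Lemma induced_traceE : induced_trace = (\sum_t E t) *m induced_diag.
Proof.
apply: eq_block_proj => t; rewrite -mulmxA induced_diag_proj mulmx1 mulmx_suml.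
pose a0 : 'I_q := alpha u.
have a0P c : (alpha c == 0%N :> nat) = (alpha c == a0).
  by rewrite -val_eqE /= /a0 (split_alpha1 H_split).
rewrite (eq_bigl _ _ a0P).
have /choice[h hP] t' := split_unique H_split t t' a0.
rewrite (reindex h) /=.
  apply: eq_big => [t'|t' _]; first by rewrite (hP t').1.2 eqxx.
  rewrite induced_act_proj (hP t').1.1 (hP t').1.2 (torsor_act0 torT) ?mulmx1 //.
  exact: split_alpha1 H_split.
exists (fun c => act t c) => [t' _|c]; first exact: (hP t').1.1.
by rewrite inE => /eqP ac; apply/esym/(hP _).2.
Qed.

Lemma induced_diag_trace : induced_diag = J t0 *m induced_trace.
Proof.
rewrite induced_traceE mulmxA -[LHS]mul1mx; congr (_ *m _).
rewrite mulmx_sumr (bigD1 t0) //= block_injK eqxx big1 ?addr0 // => t tt0.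
by rewrite block_injK eq_sym (negPf tt0) raddf0.
Qed.

End InducedTorsor.

Section DescendInduced.
Variables (L K : fieldType) (j : {rmorphism L -> K}) (q n : nat).
Variables (ML : 'M[L]_n) (ML_unit : ML \in unitmx).
Variables (mu : 'I_n -> 'I_n -> 'I_n) (u : 'I_n).
Variables (X : finType) (act : X -> 'I_n -> X) (alpha : 'I_n -> 'I_q) (pw : 'I_q -> 'I_n).
Variable t0 : X.
Hypothesis X_split : cyclic_splitting mu u act alpha pw.
Variables (T : fin_space K q) (torT : is_torsor (const_Zm K q) T).
Local Notation M := (map_mx j ML).
Local Notation T' := (induced_torsor M act alpha T).
Variable S1 : fin_space L n.
Hypothesis S1_iso : space_iso (space_bc j S1) T'.

(* The [H]-invariants of the induced algebra are the image of the trace over [H],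
   a matrix which descends to [L]; its row space is the algebra of [S]. *)
Lemma descend_induced_torsor :
  exists S : fin_space L q, is_torsor (const_Zm L q) S /\ space_iso (space_bc j S) T.
Proof.
have M_unit : M \in unitmx by rewrite map_unitmx.
have [f [/mulmxr_bij[g fg gf] f_hom f_act]] := S1_iso.
pose sig c := action_mx (@coact_basis L n S1) (col c ML).
have sigE c : map_mx j (sig c) = f *m induced_act act alpha T c *m g.
  have := action_mx_morph (col c M) f_act; rewrite action_coaction_of // => <-.
  by rewrite -mulmxA fg mulmx1 /sig map_action_mx map_col.
pose W := \sum_(c | alpha c == 0%N :> nat) sig c.
have WE : map_mx j W = f *m induced_trace act alpha T *m g.
  rewrite /W raddf_sum mulmx_sumr mulmx_suml; apply: eq_bigr => c _; exact: sigE.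
pose diag := induced_diag X T; pose E0 := diag *m g.
have E0_W : E0 = (block_inj K (space_dim T) t0 *m g) *m map_mx j W.
  rewrite /E0 /diag (induced_diag_trace t0 X_split torT) WE !mulmxA.
  by rewrite -[_ *m g *m f]mulmxA gf mulmx1.
have W_E0 : exists Y, map_mx j W = Y *m E0.
  rewrite WE (induced_traceE X_split torT) mulmxA -mulmxA.
  by exists (f *m (\sum_t block_proj K (space_dim T) t)).
have E0_inj m (Y Z : 'M[K]_(m, space_dim T)) : Y *m E0 = Z *m E0 -> Y = Z.
  move=> /(congr1 (mulmx^~ (f *m block_proj K (space_dim T) t0))); rewrite /E0 -!mulmxA.
  by rewrite (mulmxA g) gf mul1mx induced_diag_proj !mulmx1.
pose B := row_base W.
have B_W : (map_mx j B :=: map_mx j W)%MS.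
  by apply/eqmxP; rewrite !map_submx; exact/eqmxP/eq_row_base.
have [Q' Q'P] : exists Q', E0 = Q' *m map_mx j B.
  by apply/submxP; rewrite B_W E0_W submxMl.
have [Q QP] : exists Q, map_mx j B = Q *m E0.
  by apply/submxP; rewrite B_W; have [Y ->] := W_E0; rewrite submxMl.
have B_free : row_free (map_mx j B) by rewrite row_free_map row_base_free.
have QQ' : Q *m Q' = 1%:M.
  by apply: (row_free_inj B_free); rewrite -mulmxA -Q'P -QP mul1mx.
have Q'Q : Q' *m Q = 1%:M.
  by apply: E0_inj; rewrite -mulmxA -QP -Q'P mul1mx.
have lift m (y : 'M[L]_(m, space_dim S1)) z :
    map_mx j y = z *m E0 -> exists x, map_mx j x *m Q = z.
  move=> yz; have /submxP[x defy] : (y <= B)%MS.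
    by rewrite -(map_submx j) yz Q'P mulmxA submxMl.
  by exists x; apply: E0_inj; rewrite -mulmxA -QP -map_mxM -defy.
have E0_hom : is_alg_hom T (space_bc j S1) E0.
  have [diag1 diagM] := induced_diag_hom X T; have [f1 fM] := f_hom.
  have g_inj m (Y Z : 'M[K]_(m, space_dim S1)) : Y *m f = Z *m f -> Y = Z.
    by move=> YZ; rewrite -[Y]mulmx1 -[Z]mulmx1 -fg !mulmxA YZ.
  have E0f : E0 *m f = diag by rewrite /E0 -mulmxA gf mulmx1.
  split=> [|v w]; apply: g_inj; rewrite -mulmxA E0f.
    by rewrite diag1 f1.
  by rewrite diagM fM -(mulmxA v) -(mulmxA w) E0f.
apply: (descend_const_torsor QQ' Q'Q torT).
- by have [E01 _] := E0_hom; exact: lift (esym E01).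
- move=> a b; apply: (lift _ (mul_alg S1 (row a B) (row b B))).
  have [_ E0M] := E0_hom; rewrite map_mul_alg E0M -!row_mul -QP !map_row.
  by [].
move=> c; apply: (lift _ (B *m sig (pw c))).
have E0_act : E0 *m map_mx j (sig (pw c)) = torsor_act T c *m E0.
  rewrite sigE /E0 !mulmxA -[diag *m g *m f]mulmxA gf mulmx1.
  by rewrite (induced_diag_act X_split).
transitivity (Q *m (E0 *m map_mx j (sig (pw c)))); first by rewrite mulmxA -QP map_mxM.
by rewrite E0_act mulmxA.
Qed.

End DescendInduced.

Section Factor.
Variables (R S K : fieldType) (j : {rmorphism S -> K}) (i : {rmorphism R -> K}).

Definition factor_fun (i_im : forall x, exists y, j y = i x) (x : R) : S := sval (cid (i_im x)).

Hypothesis i_im : forall x, exists y, j y = i x.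

Lemma factor_funK x : j (factor_fun i_im x) = i x.
Proof. exact: svalP (cid (i_im x)). Qed.

Fact factor_fun_zmod : zmod_morphism (factor_fun i_im).
Proof. by move=> x y; apply: (fmorph_inj j); rewrite rmorphB !factor_funK rmorphB. Qed.
Fact factor_fun_monoid : monoid_morphism (factor_fun i_im).
Proof.
by split=> [|x y]; apply: (fmorph_inj j); rewrite ?rmorphM !factor_funK ?rmorph1 ?rmorphM.
Qed.

HB.instance Definition _ := GRing.isZmodMorphism.Build R S (factor_fun i_im) factor_fun_zmod.
HB.instance Definition _ := GRing.isMonoidMorphism.Build R S (factor_fun i_im) factor_fun_monoid.

End Factor.

Lemma space_bc_comp (F L K : fieldType) (i : {rmorphism F -> L}) (j : {rmorphism L -> K})
  (h : {rmorphism F -> K}) n (T : fin_space F n) :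
  j \o i =1 h -> space_bc j (space_bc i T) = space_bc h T.
Proof.
move=> ji; have map_ji m l (X : 'M[F]_(m, l)) : map_mx j (map_mx i X) = map_mx h X.
  by rewrite -map_mx_comp; exact: eq_map_mx.
rewrite /space_bc /alg_bc /=; congr (@FinSpace K n _ (FinAlg _ _) _); last 1 first.
- by apply/funext => a; exact: map_ji.
- by apply/funext => a; apply/funext => b; exact: map_ji.
exact: map_ji.
Qed.

Lemma least_le (P : nat -> Prop) n : P n -> le_enat (least P) (Some n).
Proof.
move=> Pn; rewrite /least; case: pselect => [h|[]]; last by exists n; apply/asboolP.
by case: ex_minnP => m _ m_min; apply: m_min; apply/asboolP.
Qed.

Lemma least_SomeP (P : nat -> Prop) n : least P = Some n -> P n.
Proof.
rewrite /least; case: pselect => // h [<-].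
by case: ex_minnP => m /asboolP.
Qed.

Lemma le_enat_least (P : nat -> Prop) n :
  le_enat (least P) (Some n) -> exists2 m, (m <= n)%N & P m.
Proof.
case least_P: (least P) => [m|//] mn.
by exists m => //; exact: least_SomeP.
Qed.

Lemma algebraic_over_mpoly_bc (k F L K : fieldType) (h : {rmorphism k -> F})
  (i : {rmorphism k -> L}) (iota : {rmorphism F -> K}) (j : {rmorphism L -> K}) n
  (t : 'I_n -> L) (x : L) :
  j \o i =1 iota \o h -> injective (mmap i t) ->
  (exists2 P : {poly {mpoly k[n]}}, P != 0 & root (map_poly (mmap i t) P) x) ->
  algebraic_over_mpoly iota (j \o t) (j x).
Proof.
move=> jh t_inj [P Pn0 Px].
pose hm : {rmorphism {mpoly k[n]} -> {mpoly F[n]}} := map_mpoly h.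
have hmE Q : mmap iota (j \o t) (hm Q) = j (mmap i t Q).
  rewrite rmorph_mmap [RHS]rmorph_mmap /mmap; apply: eq_bigr => m _; congr (_ * _).
    by rewrite /= mmapC; exact: esym (jh _).
  by apply: mmap1_eq => l; rewrite /= mmapX mmap1U.
have mapE : map_poly (mmap iota (j \o t)) (map_poly hm P) = map_poly j (map_poly (mmap i t) P).
  by rewrite -!map_poly_comp; apply: eq_map_poly => Q; exact: hmE.
exists (map_poly hm P); rewrite mapE; last by rewrite fmorph_root.
rewrite map_poly_eq0; apply: contra_neq Pn0 => P0.
by apply: (map_inj_poly t_inj); rewrite ?rmorph0 // P0.
Qed.

(** * Essential dimension *)

Lemma le_enat_trans x m n : le_enat x (Some m) -> (m <= n)%N -> le_enat x (Some n).
Proof. by case: x => // l; exact: leq_trans. Qed.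

Lemma ed_const_le (p n : nat) (k : fieldType) :
  p \in [pchar k] -> le_enat (ed (const_Zm k (p ^ n))) (Some n).
Proof.
move=> pchar_k; apply: least_le => K iota T; rewrite hopf_bc_const => torT.
have pchar_K : p \in [pchar K] by rewrite (rmorph_pchar iota pchar_k).
have [m lemn mP] := cyclic_torsor_defined iota pchar_K torT.
exact: le_enat_trans (least_le mP) lemn.
Qed.

Lemma ed_split_ge (k K0 : fieldType) (f : {rmorphism k -> K0}) n (G : fin_hopf k n)
  (M0 : 'M[K0]_n) q mu u (X : finType) (act : X -> 'I_n -> X) (alpha : 'I_n -> 'I_q) pw (t0 : X) N :
  M0 \in unitmx -> (forall c, is_point (hopf_bc f G) (col c M0)) ->
  (forall a b, convol (hopf_bc f G) (col a M0) (col b M0) = col (mu a b) M0) ->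
  counit (hopf_bc f G) = col u M0 ->
  cyclic_splitting mu u act alpha pw ->
  ed G = Some N -> le_enat (ed (const_Zm K0 q)) (Some N).
Proof.
move=> M_unit M_pt muP uP X_split edG; apply: least_le => K iota T.
rewrite hopf_bc_const => torT; pose h : {rmorphism k -> K} := iota \o f.
pose M := map_mx iota M0; pose T' := induced_torsor M act alpha T.
have hG : hopf_bc iota (hopf_bc f G) = hopf_bc h G by exact: hopf_bc_comp.
have torT' : is_torsor (hopf_bc h G) T'.
  rewrite -hG; apply: (is_torsor_induced (mu := mu) (u := u) (pw := pw) _ _ _ _ t0) => //.
  - by rewrite map_unitmx.
  - by move=> c; rewrite -map_col; exact: is_point_bc.
  - by move=> a b; rewrite -!map_col -map_convol muP.
  - by rewrite -map_col -uP.
have [N' leN' [L0 [i0 [j0 [ji0 [t [t_inj t_alg]] [S0 torS0 S0_iso]]]]]] :=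
  le_enat_least (least_SomeP edG _ h _ torT').
have [L [iL [j [m [lemN' jiL L_trdeg L_alg]]]]] := trdeg_subfield iota (j0 \o t).
have j0_im x : exists y, j y = j0 x.
  apply: L_alg; apply: (algebraic_over_mpoly_bc (h := f) (i := i0)) => //.
pose i1 : {rmorphism L0 -> L} := factor_fun j0_im.
have ji1 : j \o i1 =1 j0 := factor_funK j0_im.
have map_M : map_mx j (map_mx iL M0) = M by rewrite -map_mx_comp; exact: eq_map_mx.
have [S [torS S_iso]] : exists S : fin_space L q,
    is_torsor (const_Zm L q) S /\ space_iso (space_bc j S) T.
  apply: (descend_induced_torsor (ML := map_mx iL M0) (S1 := space_bc i1 S0) _ t0 X_split torT).
    by rewrite map_unitmx.
  by rewrite map_M (space_bc_comp _ ji1).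
have : defined_in_trdeg iota (const_Zm K0 q) T m.
  by exists L, iL, j; split=> //; exists S => //; rewrite hopf_bc_const.
by move=> /least_le/le_enat_trans; apply; exact: leq_trans leN'.
Qed.

Theorem lemma2p1 (p : nat) (p_prime : prime p) :
  (forall k : fieldType, p \in [pchar k] ->
     forall n : nat, (1 <= n)%N -> ed (const_Zm k (p ^ n)) = Some n)
  <->
  (forall (k : fieldType) (pchar_k : p \in [pchar k])
     (m : nat) (G : fin_hopf k m),
     is_group_scheme G -> (1 < m)%N -> is_commutative G ->
     is_unipotent G -> is_etale G ->
     le_enat (V_order pchar_k G) (ed G)).
Proof.
split=> [ledet k pchar_k m G G_group m_gt1 G_comm G_unip [K0 [f [M0 [M0_hom M0_bij]]]]|ed_ge].
  have pchar_K0 : p \in [pchar K0] by rewrite (rmorph_pchar f pchar_k).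
  have M0_unit : M0 \in unitmx.
    by have [M' MM' _] := mulmxr_bij M0_bij; have [] := mulmx1_unit MM'.
  have [mu [u [e [X [act [alpha [pw [t0 [muP uP exp_e e_gt0 X_split]]]]]]]]] :=
    split_group_splitting pchar_K0 G_group G_comm G_unip m_gt1 M0_unit M0_hom.
  have M0_pt := split_col_point M0_hom.
  case edG : (ed G) => [N|]; last by case: (V_order _ _).
  have := ed_split_ge t0 M0_unit M0_pt muP uP X_split edG.
  rewrite (ledet K0 pchar_K0 e e_gt0) /= => leN.
  apply: le_enat_trans leN; apply: least_le; split=> //.
  apply: (@verschiebung_trivialP p k K0 f pchar_k pchar_K0 e m G M0) => // [|c].
  - exact: group_scheme_com_coalg.
  - by have [] := M0_pt c.
move=> k pchar_k n n_gt0.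
have q_gt1 : (1 < p ^ n)%N by rewrite -(expn0 p) ltn_exp2l // prime_gt1.
have q_gt0 := ltnW q_gt1.
have := ed_ge k pchar_k _ _ (const_group_scheme k q_gt0) q_gt1 (@const_commutative k _)
  (const_unipotent q_gt0 pchar_k erefl) (@const_etale k _).
have := ed_const_le n pchar_k; case: (ed _) => //= l ln.
case V_eq : (V_order _ _) => [v|//] /= vl.
have [_ /const_verschiebung_trivial nv] := least_SomeP V_eq.
by congr Some; apply/eqP; rewrite eqn_leq ln (leq_trans nv vl).
Qed.
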